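(* Consider the Markov-modulated M/M/1 queue with finitely many background states, and let $Q$ denote its steady-state queue length. As $\rho\uparrow 1$, the random variable $(1-\rho)Q$ converges in distribution to an exponentially distributed random variable with mean $$\frac{\alpha^\circ}{2\,\tau\,\boldsymbol{\pi}\boldsymbol{\mu}}.$$
   Context: Model. Fix $d\in\mathbb{N}$. A background process $(J_t)_{t\ge 0}$ is an irreducible continuous-time Markov chain on $\{1,\dots,d\}$, jumping from $i$ to $j\neq i$ at rate $q_{ij}$; put $q_i:=-q_{ii}:=\sum_{j\ne i}q_{ij}$. When the background state is $i$, customers arrive at (Poisson) rate $\lambda_i\ge 0$ and the single server works at exponential service rate $\mu_i\ge 0$ (rates updated in real time). So with $Q_t$ the number of customers at time $t$, $(Q_t,J_t)$ is a Markov chain on $\{0,1,2,\dots\}\times\{1,\dots,d\}$ with transitions $(k,i)\to(k+1,i)$ at rate $\lambda_i$, $(k,i)\to(k-1,i)$ at rate $\mu_i$ if $k\ge 1$, and $(k,i)\to(k,j)$ at rate $q_{ij}$, $j\neq i$. $(Q,J)$ denotes the steady-state version of $(Q_t,J_t)$. Notation. $\boldsymbol{\pi}$ is the row vector of steady-state probabilities of the background process; $\boldsymbol{\lambda}=(\lambda_1,\dots,\lambda_d)^\top$, $\boldsymbol{\mu}=(\mu_1,\dots,\mu_d)^\top$; the load is $\rho:=\boldsymbol{\pi}\boldsymbol{\lambda}/\boldsymbol{\pi}\boldsymbol{\mu}$. Heavy-traffic regime. The matrix $(q_{ij})$ and the vector $\boldsymbol{\mu}$ (with $\boldsymbol{\pi}\boldsymbol{\mu}>0$)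 are kept fixed, and $\boldsymbol{\lambda}=c\,\boldsymbol{\lambda}_0$ for a fixed vector $\boldsymbol{\lambda}_0$ of arrival rates with $\rho_0:=\boldsymbol{\pi}\boldsymbol{\lambda}_0/\boldsymbol{\pi}\boldsymbol{\mu}\in(0,1)$; thus $\rho=c\rho_0$, and $\rho\uparrow 1$ means $c\uparrow\rho_0^{-1}$. The matrix $A(z)$ is the $d\times d$ matrix with entries $$a_{ij}(z):=\lambda_i(z-1)1_{\{i=j\}}+\mu_i\Big(\frac1z-1\Big)1_{\{i=j\}}+q_{ji},$$ $\alpha(z):=\det A(z)$ (which depends on $\rho$ through $\boldsymbol{\lambda}$), and $\alpha^\circ:=\lim_{\rho\uparrow 1}\alpha''(1)$. The number $\tau:=\det T$, where $T$ is the $d\times d$ matrix whose $(i,j)$ entry equals $1$ if $i=1$ and $q_{ji}$ if $i\neq 1$. *)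

(* Defs.v *)
From HB Require Import structures.
From mathcomp Require Import all_boot all_order all_algebra.
From mathcomp Require Import all_classical all_reals all_analysis.
From mathcomp Require Import measurable_realfun.

Set Implicit Arguments.
Unset Strict Implicit.
Unset Printing Implicit Defensive.

Import Order.TTheory GRing.Theory Num.Theory.
Import numFieldNormedType.Exports.

Local Open Scope classical_set_scope.
Local Open Scope ring_scope.

(** ** Continuous-time Markov chains *)

(* [p] is a stationary (steady-state) distribution of the continuous-time
   Markov chain on [S] that jumps from [x] to [y != x] at rate [r x y]: total
   mass 1, and outflow equals inflow at every state (p G = 0 for the generator
   G).  The values [r x x] are irrelevant. *)
Definition stationary (R : realType) (S : choiceType) (r : S -> S -> R)
    (p : S -> \bar R) : Prop :=
  [/\ forall x, (0 <= p x)%E,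
      (\esum_(x in [set: S]) p x = 1)%E
    & forall y, (p y * (\esum_(z in ~` [set y]) (r y z)%:E) =
                 \esum_(x in ~` [set y]) (p x * (r x y)%:E))%E].

Definition is_generator (R : realType) (d : nat) (q : 'M[R]_d) : Prop :=
  (forall i j, i != j -> 0 <= q i j) /\
  (forall i, q i i = - \sum_(j < d | j != i) q i j).

Definition irreducible_chain (R : realType) (d : nat) (q : 'M[R]_d) : Prop :=
  forall i j, connect (fun a b => (a != b) && (0 < q a b)) i j.

(** ** The Markov-modulated M/M/1 queue *)

(* Jump rates of (Q_t, J_t) on {0,1,2,...} x {1,...,d}. *)
Definition mm1_rate (R : realType) (d : nat) (q : 'M[R]_d) (lam mu : 'cV[R]_d)
    (x y : nat * 'I_d) : R :=
  let: (k, i) := x in let: (l, j) := y in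
  if (l == k.+1) && (j == i) then lam i 0
  else if (k == l.+1) && (j == i) then mu i 0
  else if (l == k) && (j != i) then q i j
  else 0.

(* The product pi v of a row and a column vector, as a scalar. *)
Definition rc (R : realType) (d : nat) (p : 'rV[R]_d) (v : 'cV[R]_d) : R :=
  (p *m v) 0 0.

Definition load (R : realType) (d : nat) (p : 'rV[R]_d) (lam mu : 'cV[R]_d) : R :=
  rc p lam / rc p mu.

Definition matA (R : realType) (d : nat) (q : 'M[R]_d) (lam mu : 'cV[R]_d)
    (z : R) : 'M[R]_d :=
  \matrix_(i, j) (lam i 0 * (z - 1) * (i == j)%:R
                  + mu i 0 * (1 / z - 1) * (i == j)%:R + q j i).

Definition alpha (R : realType) (d : nat) (q : 'M[R]_d) (lam mu : 'cV[R]_d)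
    (z : R) : R := \det (matA q lam mu z).

(* The limit of alpha''(1) as lam = c lam0 with c increasing to 1 / rho0. *)
Definition alpha_circ (R : realType) (d : nat) (q : 'M[R]_d)
    (lam0 mu : 'cV[R]_d) (rho0 : R) : R :=
  lim (derive1n 2 (alpha q (c *: lam0) mu) 1 @[c --> rho0^-1^'-]).

Definition tau (R : realType) (d : nat) (q : 'M[R]_d) : R :=
  \det (\matrix_(i < d, j < d) if i == 0%N :> nat then 1 else q j i).

(** ** Random variables *)

Definition joint_law (R : realType) (d : nat) (dO : measure_display)
    (Omega : measurableType dO) (P : probability Omega R)
    (Q : {RV P >-> nat}) (J : Omega -> 'I_d) (x : nat * 'I_d) : \bar R :=
  P [set w | (Q w, J w) = x].

Section scaled.
Context (R : realType) (dO : measure_display) (Omega : measurableType dO)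
  (P : probability Omega R).

Definition scaled (a : R) (Q : {RV P >-> nat}) (w : Omega) : R := a * (Q w)%:R.

Lemma measurable_scaled a Q : measurable_fun [set: Omega] (scaled a Q).
Proof.
apply: measurable_funM => //.
by apply: (@measurableT_comp _ _ _ _ _ _ (fun n : nat => n%:R : R)).
Qed.

HB.instance Definition _ a Q :=
  isMeasurableFun.Build _ _ _ _ (scaled a Q) (measurable_scaled a Q).

Definition scaled_rv (a : R) (Q : {RV P >-> nat}) : {RV P >-> R} := scaled a Q.

End scaled.

(* Convergence in distribution, along the filter [F], of real random variables
   (possibly on different probability spaces) to the law [nu]: convergence of
   the distribution functions at every continuity point of the limit. *)
Definition cvg_in_distribution (R : realType) (I : Type) (F : set_system I)
    (dO : I -> measure_display) (Omega : forall i, measurableType (dO i))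
    (P : forall i, probability (Omega i) R) (X : forall i, {RV (P i) >-> R})
    (nu : set R -> \bar R) : Prop :=
  forall x : R, {for x, continuous (fun r : R => nu `]-oo, r]%classic)} ->
    cdf (X i) x @[i --> F] --> nu `]-oo, x]%classic.
Arguments cvg_in_distribution {R I} F {dO Omega} P X nu.

(* The library parametrizes the exponential law by its rate. *)
Definition exponential_of_mean (R : realType) (m : R) : set R -> \bar R :=
  exponential_prob m^-1.

(* Main.v *)
Require Import Defs.
From mathcomp Require Import all_boot all_order all_algebra.
From mathcomp Require Import all_classical all_reals all_analysis.
From mathcomp Require Import ring lra zify.

(* Write M(z) = z A(z).  The generating functions g_i(z) = E[z^Q; J = i] satisfy
   M(z) g(z) = (1 - z) w with w_i = mu_i P(Q = 0, J = i), and balancing the flow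
   between consecutive levels gives sum_i w_i = (1 - rho) pi mu.  By Cramer's
   rule, det M(z) / (z - 1) * E[z^Q] = - 1^T adj(M(z)) w.  At z = 1 the adjugate
   is tau pi^T 1^T, and det M(z) / (z - 1) is the polynomial
   - tau (1 - rho) pi mu + (z - 1) B(c, z) with 2 B = alpha'' at the critical
   point, so that z = exp(- s (1 - rho)) yields
   E[z^Q] -> pi mu / (pi mu + s alpha_circ / (2 tau)).
   The limit mean is positive because alpha_circ / (2 tau) equals pi mu plus the
   Dirichlet form of the solution y of q y = mu - lambda.

   Convergence of Laplace transforms is turned into convergence of distribution
   functions by comparison with the geometric law of ratio exp(- (1 - rho) / m),
   which has the same limiting transform: the functions (1 - exp (- p x))^n are
   combinations of exponentials and approximate indicators of half-lines. *)

Set Implicit Arguments.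
Unset Strict Implicit.
Unset Printing Implicit Defensive.

Import Order.TTheory GRing.Theory Num.Theory.
Import numFieldNormedType.Exports.

Local Open Scope classical_set_scope.
Local Open Scope ring_scope.

(** * Generators of irreducible chains *)

Section generator.
Context (R : realType) (d : nat) (q : 'M[R]_d).
Hypotheses (q_gen : is_generator q) (q_irr : irreducible_chain q).

Lemma generator_mulmxE (v : 'cV[R]_d) i :
  (q *m v) i 0 = \sum_(j | j != i) q i j * (v j 0 - v i 0).
Proof.
rewrite mxE (bigD1 i)//= (q_gen.2 i) mulNr mulr_suml addrC -sumrB.
by apply: eq_bigr => j _; rewrite mulrBr.
Qed.

Lemma generator_const : q *m const_mx 1 = 0 :> 'cV_d.
Proof.
apply/matrixP => i j; rewrite ord1 generator_mulmxE !mxE big1// => k _.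
by rewrite !mxE subrr mulr0.
Qed.

Lemma generator_row_sum i : \sum_j q i j = 0.
Proof.
have /colP/(_ i) := generator_const; rewrite !mxE => h; rewrite -[RHS]h.
by apply: eq_bigr => j _; rewrite mxE mulr1.
Qed.

(* Maximum principle: the maximum of a harmonic vector spreads along the edges
   of the chain. *)
Lemma generator_ker_const (v : 'cV[R]_d) : q *m v = 0 ->
  forall i j, v i 0 = v j 0.
Proof.
move=> qv0; suff H : 'I_d -> exists M, forall j, v j 0 = M.
  by move=> i j; have [M vM] := H i; rewrite !vM.
move=> i; have [k _ kmax] :=
  @Order.TotalTheory.arg_maxP _ _ _ i xpredT (fun j => v j 0) isT.
exists (v k 0) => j; have /connectP[s ps ->] := q_irr k j.
have edge a b : v a 0 = v k 0 -> (a != b) && (0 < q a b) -> v b 0 = v k 0.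
  move=> vak /andP[ab qab]; have := generator_mulmxE v a.
  rewrite qv0 mxE => /esym sum0.
  have /(_ b) : forall b, b != a -> - (q a b * (v b 0 - v a 0)) = 0.
    move=> c ca; apply: (psumr_eq0P (P := fun c => c != a)
      (F := fun c => - (q a c * (v c 0 - v a 0)))) => //.
      move=> e ea; rewrite -mulrN opprB mulr_ge0//.
        by apply: q_gen.1; rewrite eq_sym.
      by rewrite subr_ge0 vak; exact: kmax.
    by rewrite sumrN sum0 oppr0.
  rewrite eq_sym ab => /(_ isT) /eqP; rewrite oppr_eq0 mulf_eq0 gt_eqF//=.
  by rewrite subr_eq0 vak => /eqP.
have spread x : v x 0 = v k 0 ->
    path (fun a b => (a != b) && (0 < q a b)) x s -> v (last x s) 0 = v k 0.
  elim: s x {ps} => [//|b s IH] x/= vx /andP[xb pb].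
  by apply: IH => //; apply: edge xb.
exact: spread.
Qed.

Context (d_gt0 : (0 < d)%N).
Let i0 := Ordinal d_gt0.

(** [kermx] is a left kernel, so the right kernel of [q] appears as [kermx q^T]; the maximum
    principle makes it the line of constant vectors. *)
Lemma generator_rank : \rank q = d.-1.
Proof.
rewrite -mxrank_tr; have := mxrank_ker q^T.
suff -> : \rank (kermx q^T) = 1%N.
  by move=> h; rewrite -subn1 h subKn// rank_leq_row.
apply/eqP; rewrite eqn_leq; apply/andP; split.
  suff /mxrankS h : (kermx q^T <= (const_mx 1 : 'rV[R]_d))%MS.
    by apply: leq_trans h _; exact: rank_leq_row.
  apply/row_subP => i; set r := row i _.
  have rq : r *m q^T = 0 by apply/sub_kermxP; exact: row_sub.
  have /generator_ker_const rc : q *m r^T = 0.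
    by apply: trmx_inj; rewrite trmx_mul trmxK rq trmx0.
  apply/sub_rVP; exists (r 0 i0); apply/rowP => j.
  by rewrite !mxE mulr1; have := rc j i0; rewrite !mxE.
rewrite lt0n mxrank_eq0; apply/eqP => k0.
have : ((const_mx 1 : 'rV[R]_d) <= kermx q^T)%MS.
  apply/sub_kermxP; apply: trmx_inj.
  by rewrite trmx_mul trmxK trmx_const generator_const trmx0.
rewrite k0 submx0 => /eqP/rowP/(_ i0)/eqP.
by rewrite !mxE oner_eq0.
Qed.

Context (p : 'rV[R]_d) (p_stat : p *m q = 0) (p_sum : \sum_i p 0 i = 1).

(** By [generator_rank] the left kernel is a line, and it contains [p]; summing coordinates fixes
    the factor because [p] has mass 1. *)
Lemma generator_left_kernel (u : 'rV[R]_d) : u *m q = 0 ->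
  u = (\sum_i u 0 i) *: p.
Proof.
move=> uq0; have p0 : p != 0.
  apply/eqP => p0; move: p_sum; rewrite p0 big1 => [/eqP|i _].
    by rewrite eq_sym oner_eq0.
  by rewrite mxE.
have rk1 : \rank (kermx q) = 1%N.
  by rewrite mxrank_ker generator_rank -subn1 subKn.
have pk : (p <= kermx q)%MS by apply/sub_kermxP.
have uk : (u <= kermx q)%MS by apply/sub_kermxP.
have kp : (kermx q <= p)%MS.
  by rewrite -(geq_leqif (mxrank_leqif_sup pk)) rk1 rank_rV p0.
have /sub_rVP[a ua] := submx_trans uk kp.
rewrite {1}ua; congr (_ *: _); rewrite ua.
by under eq_bigr do rewrite mxE; rewrite -mulr_sumr p_sum mulr1.
Qed.

(** A null vector [x] of [T] sums to zero by the first row, and the other rows make every entry of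
    [x q] but the first vanish. The columns of [q] add up to zero, so [x q = 0], and [x] is a
    multiple of [p] with sum zero. *)
Lemma generator_tau_neq0 : tau q != 0.
Proof.
apply/eqP; rewrite /tau; set T := \matrix_(i, j) _ => detT.
have /eqP/det0P[x x0 xT] : \det T^T = 0 by rewrite det_tr.
have Tx i : \sum_j T i j * x 0 j = 0.
  have /rowP/(_ i) := xT; rewrite !mxE => h; rewrite -[RHS]h.
  by apply: eq_bigr => j _; rewrite !mxE mulrC.
have xs : \sum_j x 0 j = 0.
  by rewrite -[RHS](Tx i0); apply: eq_bigr => j _; rewrite mxE/= mul1r.
have xq i : i != i0 -> (x *m q) 0 i = 0.
  move=> ii0; rewrite -[RHS](Tx i) mxE; apply: eq_bigr => j _;
    rewrite !mxE mulrC.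
  by case: ifPn => // /eqP h; move: ii0; rewrite -val_eqE/= h.
have xqs : \sum_i (x *m q) 0 i = 0.
  transitivity ((x *m q *m const_mx 1 : 'cV_1) 0 0).
    by rewrite mxE; apply: eq_bigr => j _; rewrite [const_mx _ _ _]mxE mulr1.
  by rewrite -mulmxA generator_const mulmx0 mxE.
have xq0 : x *m q = 0.
  apply/rowP => i; rewrite [RHS]mxE; have [->|/xq//] := eqVneq i i0.
  by move: xqs; rewrite (bigD1 i0)//= big1 ?addr0.
by move: x0; rewrite (generator_left_kernel xq0) xs scale0r eqxx.
Qed.

(** As [det q^T = 0], the adjugate is annihilated by [q^T] on both sides: its columns are
    proportional to [p] and its rows are constant. *)
Lemma generator_adj i j : (\adj q^T) i j = tau q * p 0 i.
Proof.
have det0 : \det q^T = 0.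
  apply/eqP; rewrite det_tr; apply/det0P; exists p => //.
  apply/eqP => p0; move: p_sum; rewrite p0 big1 => [/eqP|k _].
    by rewrite eq_sym oner_eq0.
  by rewrite mxE.
have hcol j' : (\adj q^T) i j' = (\sum_k (\adj q^T) k j') * p 0 i.
  have := mul_mx_adj q^T; rewrite det0 raddf0 => h.
  have /generator_left_kernel : (col j' (\adj q^T))^T *m q = 0.
    apply: trmx_inj; rewrite trmx_mul trmxK colE mulmxA h mul0mx.
    by rewrite trmx0.
  move=> /rowP/(_ i); rewrite !mxE => ->; congr (_ * _).
  by apply: eq_bigr => k _; rewrite !mxE.
have hrow k : (\adj q^T) k j = (\adj q^T) k i0.
  have := mul_adj_mx q^T; rewrite det0 raddf0 => h.
  have /generator_ker_const : q *m (row k (\adj q^T))^T = 0.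
    apply: trmx_inj; rewrite trmx_mul trmxK rowE -mulmxA h mulmx0.
    by rewrite trmx0.
  by move=> /(_ j i0); rewrite !mxE.
rewrite hcol; congr (_ * _).
(* [T] and [q^T] differ only in row [i0], so they share the cofactors along it; expanding [tau]
   there gives the column sum of the adjugate. *)
rewrite /tau (expand_det_row _ i0); apply: eq_bigr => k _.
rewrite hrow !mxE/= mul1r /cofactor; congr (_ * \det _).
by apply/matrixP => a b; rewrite !mxE.
Qed.

(** Fredholm alternative: every row vector annihilating the image of [q] is a multiple of [p]. *)
Lemma generator_poisson (b : 'cV[R]_d) : p *m b = 0 ->
  exists y : 'cV[R]_d, q *m y = b.
Proof.
move=> pb; suff /submxP[D bD] : (b^T <= q^T)%MS.
  by exists D^T; apply: trmx_inj; rewrite trmx_mul trmxK bD.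
rewrite submxE; apply/eqP.
have h := mulmx_coker q^T; set C := cokermx _ in h *.
have Cq : C^T *m q = 0 by apply: trmx_inj; rewrite trmx_mul trmxK h trmx0.
apply: trmx_inj; rewrite trmx_mul trmxK trmx0; apply/row_matrixP => i.
rewrite row_mul row0.
have /generator_left_kernel -> : row i C^T *m q = 0 by rewrite -row_mul Cq row0.
by rewrite -scalemxAl pb scaler0.
Qed.

(** Twice the form is the sum of [p_i q_ij (y_j - y_i)^2]. When the square is expanded, stationarity
    kills the [y_j^2] terms and zero row sums kill the [y_i^2] terms. *)
Lemma generator_dirichlet (y : 'cV[R]_d) : (forall i, 0 <= p 0 i) ->
  0 <= - \sum_i p 0 i * y i 0 * (q *m y) i 0.
Proof.
move=> p_ge0.
have half : \sum_i p 0 i * (\sum_j q i j * (y j 0 - y i 0) ^+ 2) =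
    - 2 * \sum_i p 0 i * y i 0 * (q *m y) i 0.
  have pq j : \sum_i p 0 i * q i j = 0.
    by have /rowP/(_ j) := p_stat; rewrite !mxE.
  transitivity (\sum_i \sum_j (p 0 i * q i j) * y j 0 ^+ 2
      + \sum_i p 0 i * y i 0 ^+ 2 * \sum_j q i j
      - 2 * \sum_i p 0 i * y i 0 * (q *m y) i 0).
    rewrite mulr_sumr -!big_split/= -sumrB; apply: eq_bigr => i _.
    rewrite mxE !mulr_sumr -!big_split/= -sumrB; apply: eq_bigr => j _.
    by ring.
  rewrite exchange_big/= big1 => [|j _]; last by rewrite -mulr_suml pq mul0r.
  rewrite big1 => [|i _]; last by rewrite generator_row_sum mulr0.
  by rewrite addr0 add0r mulNr.
suff : 0 <= - 2 * \sum_i p 0 i * y i 0 * (q *m y) i 0 by lra.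
rewrite -half sumr_ge0// => i _; rewrite mulr_ge0// sumr_ge0// => j _.
(* The diagonal rate may be negative, but there the difference vanishes. *)
have [->|ij] := eqVneq i j; first by rewrite subrr expr0n mulr0.
by rewrite mulr_ge0 ?sqr_ge0//; exact: q_gen.1.
Qed.

End generator.

(** * The determinant and adjugate of z A(z) *)

(* [zA] is [z A(z)], which is polynomial in [z], over an arbitrary ring so that
   it can be instantiated with polynomials in [z] and [c]. *)
Definition zA (S : comNzRingType) (d : nat) (q : 'M[S]_d) (lam mu : 'cV[S]_d)
    (z : S) : 'M[S]_d :=
  \matrix_(i, j) ((lam i 0 * z - mu i 0) * (z - 1) * (i == j)%:R + z * q j i).

(** The polynomial form of [det M(z) / (z - 1)]: the column sums of [M(z)] carry a factor [z - 1],
    and pairing them with column [k] of the adjugate, for any [k], recovers the determinant (see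
    [det_zA]). *)
Definition det_quot (S : comNzRingType) (d : nat) (q : 'M[S]_d)
    (lam mu : 'cV[S]_d) (k : 'I_d) (z : S) : S :=
  \sum_j (lam j 0 * z - mu j 0) * (\adj (zA q lam mu z)) j k.

Lemma map_zA (S S' : comNzRingType) (f : {rmorphism S -> S'}) d (q : 'M[S]_d)
    (lam mu : 'cV[S]_d) (z : S) :
  map_mx f (zA q lam mu z) = zA (map_mx f q) (map_mx f lam) (map_mx f mu) (f z).
Proof.
apply/matrixP => i j; rewrite !mxE rmorphD !rmorphM !rmorphB rmorphM rmorph1.
by rewrite rmorph_nat.
Qed.

Lemma map_det_quot (S S' : comNzRingType) (f : {rmorphism S -> S'}) d
    (q : 'M[S]_d) (lam mu : 'cV[S]_d) k (z : S) :
  f (det_quot q lam mu k z) =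
  det_quot (map_mx f q) (map_mx f lam) (map_mx f mu) k (f z).
Proof.
rewrite rmorph_sum; apply: eq_bigr => j _.
by rewrite -map_zA -map_mx_adj ![map_mx f _ _ _]mxE rmorphM rmorphB rmorphM.
Qed.

Section zA_theory.
Context (S : comNzRingType) (d : nat) (q : 'M[S]_d) (lam mu : 'cV[S]_d).
Hypothesis q_sum : forall i, \sum_j q i j = 0.
Implicit Types z : S.

Lemma zA1 : zA q lam mu 1 = q^T.
Proof. by apply/matrixP => i j; rewrite !mxE subrr mulr0 mul0r add0r mul1r. Qed.

(* When [q y = mu - lam], the right-hand side vanishes to second order at
   [z = 1]; this is how alpha''(1) is computed at the critical load. *)
Lemma zA_test_vector (y : 'cV[S]_d) z j :
  \sum_i (1 + (z - 1) * y i 0) * zA q lam mu z i j =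
  (z - 1) * ((1 + (z - 1) * y j 0) * (lam j 0 * z - mu j 0)
             + z * (q *m y) j 0).
Proof.
under eq_bigr do rewrite mxE mulrDr.
rewrite big_split/= (bigD1 j)//= eqxx big1 ?addr0; last first.
  by move=> i /negPf ->; rewrite !mulr0.
transitivity ((1 + (z - 1) * y j 0) * ((lam j 0 * z - mu j 0) * (z - 1) * 1)
   + z * (\sum_i q j i + (z - 1) * \sum_i q j i * y i 0)).
  congr (_ + _); rewrite mulrDr !mulr_sumr -big_split/=.
  by apply: eq_bigr => i _; ring.
by rewrite q_sum mxE; ring.
Qed.

Lemma zA_col_sum z j :
  \sum_i zA q lam mu z i j = (z - 1) * (lam j 0 * z - mu j 0).
Proof.
transitivity (\sum_i (1 + (z - 1) * (0 : 'cV[S]_d) i 0) * zA q lam mu z i j).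
  by apply: eq_bigr => i _; rewrite [(0 : 'cV_d) i 0]mxE mulr0 addr0 mul1r.
by rewrite zA_test_vector mulmx0 ![(0 : 'cV_d) _ 0]mxE !mulr0 !addr0 mul1r.
Qed.

(** Used with two rows [f]: the row of ones extracts one factor [z - 1] from the adjugate identity,
    and the row [1 + (z - 1) y] of [zA_test_vector] extracts two at the critical load. *)
Lemma row_adj (A : 'M[S]_d) (f : 'I_d -> S) k :
  \sum_j (\sum_i f i * A i j) * (\adj A) j k = f k * \det A.
Proof.
transitivity ((\row_i f i *m A *m \adj A) 0 k).
  rewrite [RHS]mxE; apply: eq_bigr => j _; rewrite [in RHS]mxE.
  by congr (_ * _); apply: eq_bigr => i _; rewrite mxE.
by rewrite -mulmxA mul_mx_adj mul_mx_scalar !mxE mulrC.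
Qed.

Lemma det_zA k z : \det (zA q lam mu z) = (z - 1) * det_quot q lam mu k z.
Proof.
rewrite -[LHS]mul1r -(row_adj _ (fun=> 1) k) /det_quot mulr_sumr.
apply: eq_bigr => j _; rewrite mulrA; congr (_ * _).
by rewrite -zA_col_sum; apply: eq_bigr => i _; rewrite mul1r.
Qed.

End zA_theory.

(** * Joint polynomial dependence on the arrival scale [c] and on [z] *)

Definition biconst (R : comNzRingType) : {rmorphism R -> {poly {poly R}}} :=
  polyC \o polyC.
Arguments biconst {R}.

(* Polynomials in [z], the outer variable, with coefficients polynomial in [c],
   the inner one. *)
Definition bieval (R : comNzRingType) (c z : R) :
    {rmorphism {poly {poly R}} -> R} :=
  horner_eval z \o map_poly (horner_eval c).

Section bieval_theory.
Context (R : comNzRingType).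
Implicit Types (c z : R).

Lemma bievalE c z P : bieval c z P = (map_poly (horner_eval c) P).[z].
Proof. by []. Qed.

Lemma bieval_polyC c z (a : {poly R}) : bieval c z a%:P = a.[c].
Proof. by rewrite bievalE map_polyC/= hornerC. Qed.

Lemma map_biconst m n c z (A : 'M[R]_(m, n)) :
  map_mx (bieval c z) (map_mx biconst A) = A.
Proof.
by apply/matrixP => i j; rewrite !mxE bieval_polyC hornerC.
Qed.

Lemma bieval_inner c z : bieval c z 'X%:P = c.
Proof. by rewrite bieval_polyC hornerX. Qed.

Lemma bieval_outer c z : bieval c z 'X = z.
Proof. by rewrite bievalE map_polyX hornerX. Qed.

End bieval_theory.

(** Lets the entries of the adjugate be passed to the limit when [z] moves together with [c]. *)
Lemma adj_zA_bieval (R : realType) d (q : 'M[R]_d) (lam0 mu : 'cV[R]_d) :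
  exists A : 'M[{poly {poly R}}]_d, forall c z i j,
    (\adj (zA q (c *: lam0) mu z)) i j = bieval c z (A i j).
Proof.
set M := zA (map_mx biconst q) ('X%:P *: map_mx biconst lam0)
  (map_mx biconst mu) 'X.
exists (\adj M) => c z i j.
transitivity (map_mx (bieval c z) (\adj M) i j); last by rewrite [LHS]mxE.
by rewrite map_mx_adj map_zA map_mxZ !map_biconst bieval_inner bieval_outer.
Qed.

(** A nonzero difference would have more roots than its degree allows: the integers 0, 1, ..., which
    are distinct in characteristic zero. *)
Lemma poly_ext (R : numDomainType) (p p' : {poly R}) :
  (forall x, p.[x] = p'.[x]) -> p = p'.
Proof.
move=> pp'; apply/eqP; rewrite -subr_eq0; apply: contraT => nz.
have := @max_poly_roots _ (p - p') [seq n%:R | n <- iota 0 (size (p - p'))] nz.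
rewrite size_map size_iota ltnn; apply.
  by apply/allP => x _; rewrite /root !hornerE pp' subrr.
by rewrite map_inj_uniq ?iota_uniq//; apply: mulrIn; exact: oner_neq0.
Qed.

(** * Expansion of the determinant quotient at [z = 1] *)

Section expansion.
Context (R : realType) (d : nat) (q : 'M[R]_d) (lam0 mu : 'cV[R]_d).
Hypotheses (q_gen : is_generator q) (q_irr : irreducible_chain q).
Context (p : 'rV[R]_d) (p_stat : p *m q = 0) (p_sum : \sum_i p 0 i = 1).
Context (k : 'I_d).
Let drift c := \sum_i p 0 i * (c * lam0 i 0 - mu i 0).

Lemma det_quot1 c : det_quot q (c *: lam0) mu k 1 = tau q * drift c.
Proof.
have d_gt0 : (0 < d)%N by apply: leq_ltn_trans (ltn_ord k).
rewrite /det_quot zA1 mulr_sumr; apply: eq_bigr => i _.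
by rewrite (generator_adj q_gen q_irr d_gt0 p_stat p_sum) !mxE; ring.
Qed.

(** The factor theorem is applied over polynomials in [c], so that [P] is polynomial in both
    variables. *)
Lemma det_quot_expansion : exists P : {poly {poly R}}, forall c z,
  det_quot q (c *: lam0) mu k z = tau q * drift c + (z - 1) * bieval c z P.
Proof.
pose P1 := det_quot (map_mx biconst q) ('X%:P *: map_mx biconst lam0)
  (map_mx biconst mu) k 'X.
have P1E c z : bieval c z P1 = det_quot q (c *: lam0) mu k z.
  by rewrite map_det_quot map_mxZ !map_biconst bieval_inner bieval_outer.
have P1root : root (P1 - P1.[1]%:P) 1.
  by rewrite /root !hornerE subrr.
have [P P1P] := elimT (factor_theorem _ _) P1root.
exists P => c z; have := congr1 (bieval c z) P1P.
have P1_1 : P1.[1].[c] = bieval c 1 P1.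
  by rewrite bievalE -[1 in RHS](rmorph1 (horner_eval c)) horner_map.
rewrite rmorphB rmorphM rmorphB bieval_outer !bieval_polyC hornerC P1_1.
by rewrite !P1E det_quot1 => /eqP; rewrite subr_eq => /eqP ->; ring.
Qed.

(** This is the critical case, where the drift term has vanished. The test vector [1 + (z - 1) y]
    produces a factor [(z - 1)^2] on both sides of the adjugate identity; cancelling it and setting
    [z = 1] leaves the value. *)
Lemma bieval_quot1 (P : {poly {poly R}}) c (y : 'cV[R]_d) :
  (forall z, det_quot q (c *: lam0) mu k z = (z - 1) * bieval c z P) ->
  q *m y = mu - c *: lam0 ->
  bieval c 1 P =
    tau q * (rc p mu + \sum_i p 0 i * y i 0 * (c * lam0 i 0 - mu i 0)).
Proof.
move=> PE qy; set lam := c *: lam0 in PE qy *.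
(* [z] becomes the indeterminate, since [z - 1] must be cancelled before [z = 1] is substituted. *)
pose Q := map_mx polyC q; pose L := map_mx polyC lam; pose M := map_mx polyC mu.
pose Y := map_mx polyC y; pose h := map_poly (horner_eval c) P.
have Qsum i : \sum_j Q i j = 0.
  under eq_bigr do rewrite mxE.
  by rewrite -(rmorph_sum polyC) (generator_row_sum q_gen) rmorph0.
have quotE : det_quot Q L M k 'X = ('X - 1) * h.
  apply: poly_ext => z; pose ev : {rmorphism {poly R} -> R} := horner_eval z.
  have evC m n (A : 'M[R]_(m, n)) : map_mx ev (map_mx polyC A) = A.
    by apply/matrixP => i j; rewrite !mxE /ev/= /horner_eval hornerC.
  rewrite -[LHS]/(ev _) map_det_quot !evC /ev/= [horner_eval _ _]hornerX PE.
  by rewrite !hornerE.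
have := row_adj (zA Q L M 'X) (fun i => 1 + ('X - 1) * Y i 0) k.
rewrite (det_zA _ _ Qsum k) quotE.
have bracket j : (1 + ('X - 1) * Y j 0) * (L j 0 * 'X - M j 0)
             + 'X * (Q *m Y) j 0 =
   ('X - 1) * (M j 0 + Y j 0 * (L j 0 * 'X - M j 0)).
  have -> : Q *m Y = M - L by rewrite -map_mxM qy raddfB.
  by rewrite ![(M - L) _ _]mxE [(- L) _ _]mxE; ring.
under eq_bigr do rewrite zA_test_vector// bracket -2!mulrA.
(* Each [mulfI] removes one factor ['X - 1]; at 1 the test vector is 1 and the adjugate is that of
   [q^T]. *)
rewrite -2!mulr_sumr [RHS]mulrCA => /mulfI; rewrite -polyC1 polyXsubC_eq0.
move=> /(_ isT); rewrite [RHS]mulrCA => /mulfI; rewrite polyXsubC_eq0.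
move=> /(_ isT) /(congr1 (fun f => f.[1])).
rewrite hornerM hornerD hornerC hornerM hornerXsubC subrr mul0r addr0 mul1r.
rewrite bievalE -/h => <-; rewrite horner_sum.
rewrite /rc [(p *m mu) 0 0]mxE -big_split/= mulr_sumr; apply: eq_bigr => j _.
pose ev : {rmorphism {poly R} -> R} := horner_eval 1.
have evC m n (A : 'M[R]_(m, n)) : map_mx ev (map_mx polyC A) = A.
  by apply/matrixP => i i'; rewrite !mxE /ev/= /horner_eval hornerC.
have adj1 : ((\adj (zA Q L M 'X)) j k).[1] = tau q * p 0 j.
  have d_gt0 : (0 < d)%N by apply: leq_ltn_trans (ltn_ord k).
  rewrite -(generator_adj q_gen q_irr d_gt0 p_stat p_sum j k) -(zA1 q lam mu).
  have -> : zA q lam mu 1 = map_mx ev (zA Q L M 'X).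
    by rewrite map_zA !evC /ev/= [horner_eval _ _]hornerX.
  by rewrite -map_mx_adj [RHS]mxE.
rewrite hornerM adj1 !mxE !hornerE/=.
by ring.
Qed.

End expansion.

(** * Joint continuity, and the second derivative of [alpha] at 1 *)

Lemma cvg_bieval (R : realType) (T : Type) (F : set_system T) {FF : Filter F}
    (u v : T -> R) (c z : R) (P : {poly {poly R}}) :
  u x @[x --> F] --> c -> v x @[x --> F] --> z ->
  bieval (u x) (v x) P @[x --> F] --> bieval c z P.
Proof.
move=> uc vz; elim/poly_ind: P => [|P a ih].
  under eq_fun do rewrite rmorph0.
  by rewrite rmorph0; exact: cvg_cst.
have E c' z' : bieval c' z' (P * 'X + a%:P) = bieval c' z' P * z' + a.[c'].
  by rewrite rmorphD rmorphM bieval_outer bieval_polyC.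
rewrite E; under eq_fun do rewrite E.
apply: cvgD; first exact: cvgM.
by apply: (@continuous_cvg _ _ _ _ _ _ (horner a)) => //;
  exact: continuous_horner.
Qed.

(** The derivative is again a polynomial over a power of [x], so the same statement yields the
    second derivative. *)
Lemma is_derive_horner_frac (R : realType) (p : {poly R}) (n : nat) (z : R) :
  z != 0 -> is_derive z (1 : R) (fun x => p.[x] / x ^+ n)
    (('X * p^`() - n%:R *: p).[z] / z ^+ n.+1).
Proof.
move=> z0.
have zn0 : z ^+ n != 0 by rewrite expf_neq0.
have Xn : is_derive z (1 : R) (fun x : R => (x ^+ n)^-1)
    (- z ^- n.*2 * (n%:R * z ^+ n.-1)).
  have -> : (fun x : R => (x ^+ n)^-1) = (fun x => ('X^n).[x]^-1).
    by apply/funext => x; rewrite !hornerE.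
  have nz : ('X^n : {poly R}).[z] != 0 by rewrite !hornerE.
  apply: is_derive_eq (is_deriveV nz (is_derive_poly 'X^n z)) _.
  by rewrite derivXn !hornerE/= -exprM muln2 hornerMn hornerXn -mulrA mulr_natl.
apply: is_derive_eq (is_deriveM (is_derive_poly p z) Xn) _.
rewrite !hornerE/= -addnn exprD /GRing.scale/=.
case: n zn0 {Xn} => [|n] zn0; first by rewrite !expr0; field.
rewrite !exprS/=; field.
by rewrite expf_neq0 z0.
Qed.

Lemma alphaE (R : realType) d (q : 'M[R]_d) (lam mu : 'cV[R]_d) (z : R) :
  z != 0 -> alpha q lam mu z = \det (zA q lam mu z) / z ^+ d.
Proof.
move=> z0; rewrite /alpha; have -> : zA q lam mu z = z *: matA q lam mu z.
  apply/matrixP => i j; rewrite !mxE; case: (i == j);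
    rewrite ?mulr0 ?mulr1 ?add0r//.
  by field.
by rewrite detZ mulrAC divff ?mul1r// expf_neq0.
Qed.

(** Away from 0, [alpha = p / z^d] with [p(1) = 0], [p'(1) = a] and [p''(1) = 2 h(1)]; the power
    [z^-d] contributes [- 2 d a]. In the application [a] is [tau] times the drift and tends to 0. *)
Lemma derive2_alpha (R : realType) d (q : 'M[R]_d) (lam mu : 'cV[R]_d)
    (a : R) (h : {poly R}) :
  (forall z, \det (zA q lam mu z) = (z - 1) * (a + (z - 1) * h.[z])) ->
  derive1n 2 (alpha q lam mu) 1 = 2 * h.[1] - 2 * d%:R * a.
Proof.
move=> detE; pose p := ('X - 1%:P) * (a%:P + ('X - 1%:P) * h).
have alphaF z : z != 0 -> alpha q lam mu z = p.[z] / z ^+ d.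
  by move=> z0; rewrite alphaE// detE /p !hornerE.
have nz0 (z : R) : z != 0 -> \forall x \near z, x != 0.
  by move=> z0; apply: open_nbhs_nbhs; split => //; exact: open_neq.
have D1 z : z != 0 -> (alpha q lam mu)^`()%classic z =
    ('X * p^`() - d%:R *: p).[z] / z ^+ d.+1.
  move=> z0; rewrite derive1E; have /near_eq_derive -> :
     \forall x \near z, alpha q lam mu x = p.[x] / x ^+ d.
    by have := nz0 z z0; apply: filterS => x /alphaF.
  by have [_] := is_derive_horner_frac p d z0.
rewrite derive1nS derive1n1 derive1E; have /near_eq_derive -> :
     \forall x \near (1 : R), (alpha q lam mu)^`()%classic x =
    ('X * p^`() - d%:R *: p).[x] / x ^+ d.+1.
  by have := nz0 1 (oner_neq0 _); apply: filterS => x /D1.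
have [_ ->] :=
  is_derive_horner_frac ('X * p^`() - d%:R *: p) d.+1 (oner_neq0 R).
have dtM (f : {poly R}) : (('X - 1%:P) * f)^`() = f + ('X - 1%:P) * f^`().
  by rewrite derivM derivXsubC mul1r.
have dp : p^`() = a%:P + ('X - 1%:P) * (2 *: h + ('X - 1%:P) * h^`()).
  by rewrite dtM derivD derivC dtM scaler_nat mulr2n; ring.
have p1 : p.[1] = 0 by rewrite /p !hornerE subrr mul0r.
clearbody p; have dXp : ('X * p^`() - d%:R *: p)^`() =
    p^`() + 'X * p^`()^`() - d%:R *: p^`().
  by rewrite derivD derivN derivZ derivM derivX mul1r.
rewrite dXp !(hornerD, hornerN, hornerZ, hornerM, hornerX).
rewrite p1; have -> : p^`().[1] = a by rewrite dp !hornerE subrr mul0r addr0.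
have -> : p^`()^`().[1] = 2 * h.[1].
  by rewrite dp derivD derivC dtM add0r !hornerE subrr !mul0r !addr0.
by rewrite expr1n -natr1; field.
Qed.

(** * Generating functions of the stationary queue *)

Lemma esum_finite_support (R : realType) (S : choiceType) (D : set S)
    (f : S -> \bar R) (s : seq S) :
  uniq s -> (forall x, D x -> 0 <= f x)%E -> (forall x, x \in s -> D x) ->
  (forall x, D x -> x \notin s -> f x = 0%E) ->
  (\esum_(x in D) f x = \sum_(x <- s) f x)%E.
Proof.
move=> us f0 sD fs; rewrite (esumID [set` s])//.
rewrite [X in (_ + X)%E]esum1 ?adde0; last first.
  by move=> x [Dx /negP xs]; apply: fs.
have -> : D `&` [set` s] = [set` s] by apply/setIidr => x /sD.
rewrite esum_fset//; first by rewrite -fsbig_seq.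
by move=> x; rewrite inE => /sD /f0.
Qed.

(** * Balance equations as finite sums *)

Section balance.
Context (R : realType) (d : nat) (q : 'M[R]_d) (lam mu : 'cV[R]_d).
Hypotheses (q_gen : is_generator q) (lam_ge0 : forall i, 0 <= lam i 0)
  (mu_ge0 : forall i, 0 <= mu i 0).

Lemma stationary_generator (p : 'rV[R]_d) :
  stationary (fun i j => q i j) (fun i => (p 0 i)%:E) ->
  [/\ forall i, 0 <= p 0 i, \sum_i p 0 i = 1 & p *m q = 0].
Proof.
move=> [p_ge0 p_sum p_bal]; split.
- by move=> i; have := p_ge0 i; rewrite lee_fin.
- move: p_sum.
  rewrite (@esum_finite_support _ _ _ _ (enum 'I_d)) ?enum_uniq//; last first.
    by move=> x _; rewrite mem_enum.
  by rewrite big_enum/= sumEFin => -[].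
- apply/rowP => j; rewrite [RHS]mxE mxE (bigD1 j)//= (q_gen.2 j).
  have esumE (f : 'I_d -> R) : (forall i, i != j -> 0 <= f i) ->
      (\esum_(i in ~` [set j]) (f i)%:E = (\sum_(i | i != j) f i)%:E)%E.
    move=> f0; rewrite (@esum_finite_support _ _ _ _ (enum (predC1 j))).
    + by rewrite sumEFin big_enum.
    + exact: enum_uniq.
    + by move=> i /= /eqP ij; rewrite lee_fin f0.
    + by move=> i; rewrite mem_enum => /= /eqP.
    + by move=> i /= /eqP ij; rewrite mem_enum inE ij.
  have := p_bal j.
  rewrite -[X in _ = X -> _]/(\esum_(i in ~` [set j]) (p 0 i * q i j)%:E)%E.
  rewrite !esumE; last 2 first.
  + move=> i ij; rewrite mulr_ge0 ?q_gen.1//.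
    by have := p_ge0 i; rewrite lee_fin.
  + by move=> i ij; apply: q_gen.1; rewrite eq_sym.
  by move=> -[h]; rewrite mulrN h addrC subrr.
Qed.

Lemma mm1_rate_ge0 x y : 0 <= mm1_rate q lam mu x y.
Proof.
case: x y => [k i] [l j]; rewrite /mm1_rate.
case: ifP => // _; case: ifP => // _.
by case: ifP => // /andP[_ ji]; apply: q_gen.1; rewrite eq_sym.
Qed.

(** Contains every state that exchanges rate with [x] in either direction, which reduces the sums
    over the infinite state space to finite ones. *)
Definition nbrs (x : nat * 'I_d) : seq (nat * 'I_d) :=
  (x.1.+1, x.2) :: (if x.1 is k.+1 then [:: (k, x.2)] else [::]) ++
  [seq (x.1, j) | j <- enum (predC1 x.2)].

Lemma nbrs_uniq x : uniq (nbrs x).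
Proof.
case: x => k i; rewrite /nbrs/= mem_cat negb_or cat_uniq.
have uim : uniq [seq (k, j) | j <- enum (predC1 i)].
  by rewrite map_inj_uniq ?enum_uniq// => a b [].
have nim l (j : 'I_d) : l != k ->
  (l, j) \notin [seq (k, j) | j <- enum (predC1 i)].
  by move=> lk; apply/mapP => -[a _ [lk' _]]; move: lk; rewrite lk' eqxx.
rewrite nim ?uim ?andbT; last by rewrite gtn_eqF.
case: k {uim} nim => [|k] nim/=; first by apply/hasPn.
rewrite inE xpair_eqE andbC/=; apply/andP; split; last first.
  by apply/negP => /andP[]; lia.
apply/hasPn => x xs; rewrite inE; apply: contraTneq xs => ->.
by apply: nim; lia.
Qed.

Lemma sum_nbrs (f : nat * 'I_d -> R) x : \sum_(y <- nbrs x) f y =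
  f (x.1.+1, x.2) + (if x.1 is k.+1 then f (k, x.2) else 0)
  + \sum_(j | j != x.2) f (x.1, j).
Proof.
rewrite /nbrs big_cons big_cat/= addrA big_map big_enum/=; congr (_ + _ + _).
by case: x => -[|k] i; rewrite ?big_nil ?big_seq1.
Qed.

Lemma mm1_rate_nbrs x y : x != y -> x \notin nbrs y ->
  mm1_rate q lam mu x y = 0 /\ mm1_rate q lam mu y x = 0.
Proof.
case: x y => [k i] [l j]; rewrite /nbrs/= inE mem_cat !negb_or.
move=> ne /and3P[n1 n2 n3].
have {}n1 : (k == l.+1) && (i == j) = false by rewrite -xpair_eqE (negPf n1).
have {}n2 : (l == k.+1) && (i == j) = false.
  by apply/negP => /andP[/eqP lk /eqP ij]; move: n2; rewrite lk ij inE eqxx.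
have {}n3 : (k == l) && (i != j) = false.
  apply/negP => /andP[/eqP kl ij]; move: n3; rewrite kl => /negP; apply.
  by apply/mapP; exists i; rewrite ?mem_enum.
by rewrite /mm1_rate (eq_sym j i) (eq_sym l k) n1 n2 n3.
Qed.

(** At level 0 there is neither service nor inflow from below. The outflow due to background
    switches is moved to the right, as the diagonal term of the full sum over [j]. *)
Lemma mm1_balance (pr : nat -> 'I_d -> R) :
  stationary (mm1_rate q lam mu) (fun x => (pr x.1 x.2)%:E) ->
  forall k i, pr k i * (lam i 0 + if k is 0 then 0 else mu i 0) =
    (if k is k'.+1 then pr k' i * lam i 0 else 0) + pr k.+1 i * mu i 0 +
    \sum_j pr k j * q j i.
Proof.
move=> [pr_ge0 _ bal] k i; have {bal} := bal (k, i).
have nb : {subset nbrs (k, i) <= [pred y | y != (k, i)]}.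
  move=> y; rewrite inE/=; apply: contraTneq => ->.
  rewrite xpair_eqE mem_cat.
  rewrite ltn_eqF//= negb_or; apply/andP; split; last first.
    by apply/mapP => -[j]; rewrite mem_enum inE => ji [ij];
      rewrite ij eqxx in ji.
  by case: (k) => [//|k']; rewrite inE xpair_eqE; lia.
have esumE (f : nat * 'I_d -> R) : (forall x, x != (k, i) -> 0 <= f x) ->
    (forall x, x != (k, i) -> x \notin nbrs (k, i) -> f x = 0) ->
    (\esum_(x in ~` [set (k, i)]) (f x)%:E =
      (\sum_(x <- nbrs (k, i)) f x)%:E)%E.
  move=> f0 fn; rewrite (@esum_finite_support _ _ _ _ (nbrs (k, i))).
  - by rewrite sumEFin.
  - exact: nbrs_uniq.
  - by move=> x /= /eqP xk; rewrite lee_fin f0.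
  - by move=> x /nb; rewrite inE/= => /eqP.
  - by move=> x /= /eqP xk /(fn _ xk) ->.
rewrite -[X in _ = X -> _]/(\esum_(x in ~` [set (k, i)])
   (pr x.1 x.2 * mm1_rate q lam mu x (k, i))%:E)%E.
rewrite !esumE; first last.
- by move=> x xk xn; have [_ ->] := mm1_rate_nbrs xk xn.
- by move=> x xk; exact: mm1_rate_ge0.
- by move=> x xk xn; have [-> _] := mm1_rate_nbrs xk xn; rewrite mulr0.
- move=> x xk; rewrite mulr_ge0 ?mm1_rate_ge0//.
  by have := pr_ge0 x; rewrite lee_fin.
move=> -[]; rewrite !sum_nbrs/=.
have kk : (k == k.+1) = false by rewrite ltn_eqF.
have -> : \sum_(j | j != i) (if (k == k.+1) && (j == i) then lam i 0
    else if (k == k.+1) && (j == i) then mu i 0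
    else if (k == k) && (j != i) then q i j else 0) = - q i i.
  by rewrite (q_gen.2 i) opprK; apply: eq_bigr => j ji; rewrite kk eqxx ji.
have -> : \sum_(j | j != i) pr k j * (if (k == k.+1) && (i == j) then lam j 0
    else if (k == k.+1) && (i == j) then mu j 0
    else if (k == k) && (i != j) then q j i else 0) =
    \sum_(j | j != i) pr k j * q j i.
  by apply: eq_bigr => j ji; rewrite kk eqxx eq_sym ji.
rewrite [\sum_j pr k j * q j i](bigD1 i)//= !eqxx/=.
have E1 n : (n == n.+2) = false by rewrite ltn_eqF.
by case: (k) => [|k']; rewrite ?eqxx ?E1/= => h; lra.
Qed.

End balance.

Lemma cvg_sum_ord (R : realType) (T : Type) (F : set_system T) {FF : Filter F} n
    (f : 'I_n -> T -> R) (l : 'I_n -> R) :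
  (forall i, f i x @[x --> F] --> l i) ->
  \sum_i f i x @[x --> F] --> \sum_i l i.
Proof.
move=> fl; apply: (@cvg_big _ _ +%R 0 xpredT) => //.
exact: add_continuous.
Qed.

(** * The functional equation of the generating functions *)

Section generating_function.
Context (R : realType) (d : nat) (q : 'M[R]_d) (lam mu : 'cV[R]_d).
Hypotheses (q_gen : is_generator q).
Context (pr : nat -> 'I_d -> R).
Hypotheses (pr_ge0 : forall k i, 0 <= pr k i)
  (pr_sum : \sum_(k < N) \sum_i pr k i @[N --> \oo] --> (1 : R))
  (pr_balance : forall k i, pr k i * (lam i 0 + if k is 0 then 0 else mu i 0) =
    (if k is k'.+1 then pr k' i * lam i 0 else 0) + pr k.+1 i * mu i 0 +
    \sum_j pr k j * q j i).

Definition gen_partial (z : R) (i : 'I_d) (N : nat) : R :=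
  \sum_(k < N) z ^+ k * pr k i.

Definition gen_fun (z : R) : 'cV[R]_d := \col_i limn (gen_partial z i).

Lemma gen_partialS z i N :
  gen_partial z i N.+1 = gen_partial z i N + z ^+ N * pr N i.
Proof. by rewrite /gen_partial big_ord_recr. Qed.

Lemma gen_partial0 z i : gen_partial z i 0 = 0.
Proof. by rewrite /gen_partial big_ord0. Qed.

Lemma cvg_gen_fun z i : 0 <= z <= 1 ->
  gen_partial z i N @[N --> \oo] --> gen_fun z i 0.
Proof.
move=> /andP[z0 z1]; rewrite mxE; apply: nondecreasing_is_cvgn.
  apply/nondecreasing_seqP => N; rewrite gen_partialS lerDl.
  by rewrite mulr_ge0// exprn_ge0.
have tot N : \sum_(k < N) \sum_i pr k i <= 1.
  have nd : nondecreasing_seq (fun N => \sum_(k < N) \sum_i pr k i).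
    by apply/nondecreasing_seqP => n; rewrite big_ord_recr lerDl sumr_ge0.
  rewrite -(cvg_lim (@Rhausdorff R) pr_sum).
  by apply: nondecreasing_cvgn_le => //; apply/cvg_ex; exists 1.
exists 1 => _ [N _ <-]; apply: le_trans (tot N); apply: ler_sum => k _.
rewrite (bigD1 i)//= (le_trans (ler_piMl _ _)) ?exprn_ile1 ?lerDl ?sumr_ge0//.
Qed.

(** The balance equation of level [k] times [z^(k+1)], summed over [k <= N]. Arrivals and services
    shift the index by one, hence partial sums of lengths [N], [N.+1] and [N.+2]; the terms in
    [pr 0 i] account for the missing service at level 0. *)
Lemma gen_partial_balance z i N :
  z * (lam i 0 + mu i 0) * gen_partial z i N.+1 - z * mu i 0 * pr 0 i =
  z ^+ 2 * lam i 0 * gen_partial z i N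
  + mu i 0 * (gen_partial z i N.+2 - pr 0 i)
  + z * \sum_j q j i * gen_partial z j N.+1.
Proof.
elim: N => [|N IH].
  have -> : \sum_j q j i * gen_partial z j 1 = \sum_j pr 0 j * q j i.
    by apply: eq_bigr => j _; rewrite gen_partialS gen_partial0; ring.
  rewrite !gen_partialS gen_partial0; have := pr_balance 0 i.
  by move=> /(congr1 (fun x => z * x)); rewrite expr0 expr1 => h; lra.
have -> : \sum_j q j i * gen_partial z j N.+2 =
    \sum_j q j i * gen_partial z j N.+1 + z ^+ N.+1 * \sum_j pr N.+1 j * q j i.
  rewrite mulr_sumr -big_split/=; apply: eq_bigr => j _.
  by rewrite gen_partialS; ring.
have /(congr1 (fun x => z ^+ N.+2 * x)) := pr_balance N.+1 i.
move: IH; rewrite !gen_partialS !exprS expr0 mulr1; set S := \sum_j q j i * _.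
set B := \sum_j pr N.+1 j * _ => IH h.
by lra.
Qed.

(** Limit of the truncated identity. The endpoint [z = 1] is included: there the equation reads
    [q^T g(1) = 0] and identifies [g(1)] with the stationary vector. *)
Lemma gen_fun_eq z : 0 <= z <= 1 ->
  zA q lam mu z *m gen_fun z = (1 - z) *: \col_i (mu i 0 * pr 0 i).
Proof.
move=> z01; apply/colP => i; rewrite [LHS]mxE [RHS]mxE [X in _ = _ * X]mxE.
have cg i' := @cvg_gen_fun z i' z01.
have cgS i' : gen_partial z i' N.+1 @[N --> \oo] --> gen_fun z i' 0.
  by rewrite (cvg_shiftS (gen_partial z i')); exact: cg.
have cgSS i' : gen_partial z i' N.+2 @[N --> \oo] --> gen_fun z i' 0.
  rewrite (cvg_shiftS (fun N => gen_partial z i' N.+1)); exact: cgS.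
have H1 : z * (lam i 0 + mu i 0) * gen_partial z i N.+1 - z * mu i 0 * pr 0 i
   @[N --> \oo] -->
   z * (lam i 0 + mu i 0) * gen_fun z i 0 - z * mu i 0 * pr 0 i.
  by apply: cvgB; [exact: cvgMr|exact: cvg_cst].
have H2 : z ^+ 2 * lam i 0 * gen_partial z i N
  + mu i 0 * (gen_partial z i N.+2 - pr 0 i)
  + z * \sum_j q j i * gen_partial z j N.+1 @[N --> \oo] -->
  z ^+ 2 * lam i 0 * gen_fun z i 0 + mu i 0 * (gen_fun z i 0 - pr 0 i)
  + z * \sum_j q j i * gen_fun z j 0.
  apply: cvgD; last by apply: cvgMr; apply: cvg_sum_ord => j; exact: cvgMr.
  apply: cvgD; first exact: cvgMr.
  by apply: cvgMr; apply: cvgB => //; exact: cvg_cst.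
have h : z ^+ 2 * lam i 0 * gen_fun z i 0 + mu i 0 * (gen_fun z i 0 - pr 0 i)
    + z * (\sum_j q j i * gen_fun z j 0) =
    z * (lam i 0 + mu i 0) * gen_fun z i 0 - z * mu i 0 * pr 0 i.
  apply: (cvg_unique (@Rhausdorff R) H2).
  by move: H1; under eq_fun do rewrite gen_partial_balance.
transitivity ((lam i 0 * z - mu i 0) * (z - 1) * gen_fun z i 0
    + z * \sum_j q j i * gen_fun z j 0); last by lra.
rewrite mulr_sumr; under eq_bigr do rewrite [zA _ _ _ _ _ _]mxE mulrDl -[z * _ *
  _]mulrA.
rewrite big_split/= (bigD1 i)//= eqxx mulr1 big1 ?addr0// => j ji.
by rewrite eq_sym (negPf ji) mulr0 mul0r.
Qed.

Lemma gen_fun1_sum : \sum_i gen_fun 1 i 0 = 1.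
Proof.
have z01 : 0 <= (1 : R) <= 1 by rewrite ler01 lexx.
apply: (cvg_unique (@Rhausdorff R) _ pr_sum).
have -> : (fun N => \sum_(k < N) \sum_i pr k i) = (fun N => \sum_i gen_partial 1
  i N).
  apply/funext => N; rewrite exchange_big; apply: eq_bigr => i _.
  by apply: eq_bigr => k _; rewrite expr1n mul1r.
by apply: cvg_sum_ord => i; exact: cvg_gen_fun.
Qed.

(** Summing the balance equations over background states cancels the switching terms, as [q] has
    zero row sums; induction on the level then balances the crossings in the two directions. *)
Lemma cut_equation N : \sum_i lam i 0 * pr N i = \sum_i mu i 0 * pr N.+1 i.
Proof.
have tot k : \sum_i pr k i * (lam i 0 + if k is 0 then 0 else mu i 0) =
    (if k is k'.+1 then \sum_i pr k' i * lam i 0 else 0)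
    + \sum_i pr k.+1 i * mu i 0.
  under eq_bigr do rewrite pr_balance.
  rewrite !big_split/= exchange_big/= [X in _ + _ + X]big1 ?addr0.
    by case: k => [|k]//; rewrite big1_eq.
  by move=> j _; rewrite -mulr_sumr generator_row_sum// mulr0.
elim: N => [|N IH].
  have := tot 0; rewrite add0r.
  under eq_bigr do rewrite addr0 mulrC; under [in RHS]eq_bigr do rewrite mulrC.
  by [].
have := tot N.+1; under eq_bigr do rewrite mulrDr.
rewrite big_split/=.
under [in X in X + _ = _]eq_bigr do rewrite mulrC.
under [in X in _ + X = _]eq_bigr do rewrite mulrC.
under [in X in _ = X + _]eq_bigr do rewrite mulrC.
under [in X in _ = _ + X]eq_bigr do rewrite mulrC.
rewrite IH; lra.
Qed.

(** The cut equations added over all levels. *)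
Lemma gen_fun_flow :
  \sum_i lam i 0 * gen_fun 1 i 0 = \sum_i mu i 0 * (gen_fun 1 i 0 - pr 0 i).
Proof.
have trunc N : \sum_i lam i 0 * gen_partial 1 i N =
    \sum_i mu i 0 * (gen_partial 1 i N.+1 - pr 0 i).
  elim: N => [|N IH].
    rewrite !big1// => i _; rewrite ?gen_partialS gen_partial0 ?mulr0//.
    by rewrite expr0 mul1r add0r subrr mulr0.
  under eq_bigr do rewrite gen_partialS expr1n mul1r mulrDr.
  rewrite big_split/= IH cut_equation -big_split/=; apply: eq_bigr => i _.
  by rewrite (gen_partialS 1 i N.+1) expr1n; ring.
have z01 : 0 <= (1 : R) <= 1 by rewrite ler01 lexx.
have cg i' := @cvg_gen_fun 1 i' z01.
have cgS i' : gen_partial 1 i' N.+1 @[N --> \oo] --> gen_fun 1 i' 0.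
  by rewrite (cvg_shiftS (gen_partial 1 i')); exact: cg.
have H1 : \sum_i lam i 0 * gen_partial 1 i N @[N --> \oo] -->
    \sum_i lam i 0 * gen_fun 1 i 0.
  by apply: cvg_sum_ord => i; exact: cvgMr.
move: H1; under eq_fun do rewrite trunc.
move=> H1; apply: (cvg_unique (@Rhausdorff R) H1).
by apply: cvg_sum_ord => i; apply: cvgMr; apply: cvgB => //; exact: cvg_cst.
Qed.

Lemma gen_fun1 (p : 'rV[R]_d) : irreducible_chain q -> p *m q = 0 ->
  \sum_i p 0 i = 1 -> gen_fun 1 = p^T.
Proof.
move=> q_irr p_stat p_sum.
have d_gt0 : (0 < d)%N.
  case: (posnP d) p_sum => // d0; rewrite big1 => [/eqP|]; last first.
    by move=> i; have := ltn_ord i; rewrite {2}d0.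
  by rewrite eq_sym oner_eq0.
have := @gen_fun_eq 1; rewrite ler01 lexx subrr scale0r zA1 => /(_ isT) h.
have /(generator_left_kernel q_gen q_irr d_gt0 p_stat p_sum) :
    (gen_fun 1)^T *m q = 0.
  by apply: trmx_inj; rewrite trmx_mul trmxK h trmx0.
under eq_bigr do rewrite mxE; rewrite gen_fun1_sum scale1r => <-.
by rewrite trmxK.
Qed.

Lemma gen_fun_idle (p : 'rV[R]_d) : irreducible_chain q -> p *m q = 0 ->
  \sum_i p 0 i = 1 -> \sum_i mu i 0 * pr 0 i = rc p mu - rc p lam.
Proof.
move=> q_irr p_stat p_sum; have := gen_fun_flow;
  rewrite (gen_fun1 q_irr p_stat p_sum).
under [in RHS]eq_bigr do rewrite mulrBr; rewrite sumrB /rc !mxE.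
under eq_bigr do rewrite mxE mulrC;
  under [in X in _ = X - _]eq_bigr do rewrite mxE mulrC.
by lra.
Qed.

(** Multiplying the functional equation by the adjugate leaves a factor [z - 1] on both sides,
    cancelled because [z < 1]. *)
Lemma det_gen_fun (k : 'I_d) z : 0 <= z < 1 ->
  det_quot q lam mu k z * \sum_i gen_fun z i 0 =
  - \sum_i \sum_j (\adj (zA q lam mu z)) i j * (mu j 0 * pr 0 j).
Proof.
move=> /andP[z0 z1].
have eqA : zA q lam mu z *m gen_fun z = (1 - z) *: \col_i (mu i 0 * pr 0 i).
  by apply: gen_fun_eq; rewrite z0 ltW.
have := congr1 (mulmx (\adj (zA q lam mu z))) eqA; set D := det_quot _ _ _ _ _.
rewrite mulmxA mul_adj_mx mul_scalar_mx (det_zA _ _ (generator_row_sum q_gen) k)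
  -/D.
rewrite -scalemxAr => eqG.
clearbody D; have z1' : z - 1 != 0 by rewrite subr_eq0 lt_eqF.
apply: (mulfI z1'); rewrite mulrA mulrN -mulNr opprB mulr_sumr [RHS]mulr_sumr.
apply: eq_bigr => i _; have /colP/(_ i) := eqG.
rewrite [LHS]mxE [RHS]mxE => ->; congr (_ * _); rewrite mxE.
by apply: eq_bigr => j _; congr (_ * _); rewrite mxE.
Qed.

End generating_function.

(** * From Laplace transforms to the exponential limit *)

(** The expectation of [f(K)] when [K] has mass function [u], kept as a limit of real partial
    sums. *)
Definition mean (R : realType) (u f : nat -> R) : R :=
  limn (fun N => \sum_(k < N) f k * u k).

Section mean_theory.
Context (R : realType) (u : nat -> R).
Hypotheses (u_ge0 : forall k, 0 <= u k)
  (u_sum : \sum_(k < N) u k @[N --> \oo] --> (1 : R)).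
Implicit Types f g : nat -> R.

Lemma cvg_mean f : (forall k, 0 <= f k <= 1) ->
  \sum_(k < N) f k * u k @[N --> \oo] --> mean u f.
Proof.
move=> f01; apply: nondecreasing_is_cvgn.
  apply/nondecreasing_seqP => N; rewrite big_ord_recr/= lerDl.
  by rewrite mulr_ge0//; case/andP: (f01 N).
have tot N : \sum_(k < N) u k <= 1.
  have nd : nondecreasing_seq (fun N => \sum_(k < N) u k).
    by apply/nondecreasing_seqP => n; rewrite big_ord_recr lerDl.
  rewrite -(cvg_lim (@Rhausdorff R) u_sum).
  by apply: nondecreasing_cvgn_le => //; apply/cvg_ex; exists 1.
exists 1 => _ [N _ <-]; apply: le_trans (tot N); apply: ler_sum => k _.
by rewrite ler_piMl//; case/andP: (f01 k).
Qed.

Lemma mean_le f g eta : (forall k, 0 <= f k <= 1) ->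
  (forall k, 0 <= g k <= 1) ->
  (forall k, f k <= g k + eta) -> mean u f <= mean u g + eta.
Proof.
move=> f01 g01 fg.
apply: (ler_cvg_to (cvg_mean f01)
  (_ : \sum_(k < N) (g k + eta) * u k @[N --> \oo] --> _)).
  under eq_fun do under eq_bigr do rewrite mulrDl.
  under eq_fun do rewrite big_split/= -mulr_sumr.
  rewrite -[X in _ + X]mulr1; apply: cvgD; first exact: cvg_mean.
  exact: cvgMr.
by apply: nearW => N; apply: ler_sum => k _; rewrite ler_wpM2r.
Qed.

Lemma mean_ge0 f : (forall k, 0 <= f k <= 1) -> 0 <= mean u f.
Proof.
move=> f01; apply: (ler_cvg_to (cvg_cst 0) (cvg_mean f01)); apply: nearW => N.
by apply: sumr_ge0 => k _; rewrite mulr_ge0//; case/andP: (f01 k).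
Qed.

Lemma mean_compl f : (forall k, 0 <= f k <= 1) ->
  mean u (fun k => 1 - f k) = 1 - mean u f.
Proof.
move=> f01; apply: cvg_lim => //.
under eq_fun do under eq_bigr do rewrite mulrBl mul1r.
by under eq_fun do rewrite sumrB; apply: cvgB => //; exact: cvg_mean.
Qed.

Lemma mean_lin n (a : 'I_n -> R) (f : 'I_n -> nat -> R) :
  (forall j k, 0 <= f j k <= 1) ->
  mean u (fun k => \sum_j a j * f j k) = \sum_j a j * mean u (f j).
Proof.
move=> f01; apply: cvg_lim => //.
have -> : (fun N => \sum_(k < N) (\sum_j a j * f j k) * u k) =
    (fun N => \sum_j a j * \sum_(k < N) f j k * u k).
  apply/funext => N; under eq_bigr do rewrite mulr_suml.
  rewrite exchange_big/=; apply: eq_bigr => j _; rewrite mulr_sumr.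
  by apply: eq_bigr => k _; rewrite mulrA.
by apply: cvg_sum_ord => j; apply: cvgMr; exact: cvg_mean.
Qed.

End mean_theory.

Definition laplace (R : realType) (u : nat -> R) (s : R) : R :=
  mean u (fun k => expR (- (s * k%:R))).

(* Distribution function of [eps K] when [K] has the law [u] on [nat]. *)
Definition dcdf (R : realType) (u : nat -> R) (eps x : R) : R :=
  mean u (fun k => if eps * k%:R <= x then 1 else 0).

(* The double-exponential profile [x |-> (1 - e^{-p x})^n] is a combination of
   exponentials and, for large [p] and suitable [n], nearly a step function. *)
Definition gumbel (R : realType) (p : R) (n : nat) (x : R) : R :=
  (1 - expR (- (p * x))) ^+ n.

(** * Step functions from exponentials *)

Lemma bernoulli_lower (R : realType) (y : R) n : 0 <= y <= 1 ->
  1 - n%:R * y <= (1 - y) ^+ n.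
Proof.
move=> /andP[y0 y1]; elim: n => [|n IH]; first by rewrite mul0r subr0.
rewrite exprS; apply: le_trans (ler_wpM2l _ IH); last by rewrite subr_ge0.
have : 0 <= n%:R * y * y by rewrite !mulr_ge0.
by rewrite -natr1; lra.
Qed.

(** Bounds [(1 - y)^n] by [1 / (1 + n y)], which is small when [n y] is large; the lower bound
    serves when [n y] is small. *)
Lemma bernoulli_upper (R : realType) (y : R) n : 0 <= y <= 1 ->
  (1 - y) ^+ n * (1 + n%:R * y) <= 1.
Proof.
move=> /andP[y0 y1]; elim: n => [|n IH]; first by rewrite mul0r addr0 mulr1.
apply: le_trans IH; rewrite exprSr -mulrA; apply: ler_wpM2l.
  by rewrite exprn_ge0// subr_ge0.
have : 0 <= n%:R * y * y by rewrite !mulr_ge0.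
have : 0 <= y * y by rewrite !mulr_ge0.
by rewrite -natr1; lra.
Qed.

Lemma expRN_le (R : realType) (x : R) : 0 <= x -> expR (- x) <= (1 + x)^-1.
Proof.
move=> x0; rewrite expRN lef_pV2 ?posrE ?expR_gt0 ?ltr_wpDr//.
exact: expR_ge1Dx.
Qed.

Lemma gumbel01 (R : realType) (p x : R) n : 0 <= p -> 0 <= x ->
  0 <= gumbel p n x <= 1.
Proof.
move=> p0 x0; have y0 := expR_ge0 (- (p * x)).
have y1 : expR (- (p * x)) <= 1 by rewrite -expR0 ler_expR oppr_le0 mulr_ge0.
by rewrite /gumbel exprn_ge0 ?exprn_ile1//; lra.
Qed.

(** [gumbel] is small or near 1 according to whether [n e^(- p t)] is large or small. Taking [n]
    just above [L e^(p x)] makes it at least [L = 1 / eta] for [t <= x], and at most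
    [(L + 1) e^(- p (x' - x))] for [t >= x']. *)
Lemma gumbel_step (R : realType) (x x' eta : R) : 0 <= x -> x < x' -> 0 < eta ->
  exists p n, [/\ 0 <= p, forall t, 0 <= t <= x -> gumbel p n t <= eta
    & forall t, x' <= t -> 1 - eta <= gumbel p n t].
Proof.
move=> x0 xx' eta0; pose L := eta^-1; have L0 : 0 < L by rewrite invr_gt0.
have D0 : 0 < x' - x by rewrite subr_gt0.
(* Chosen so that [p (x' - x) = (L + 1) / eta]; then [e^(-a) <= 1 / (1 + a)] brings the bound for
   [t >= x'] below [eta]. *)
pose p := (L + 1) / (eta * (x' - x)).
have p0 : 0 < p by rewrite divr_gt0 ?mulr_gt0// addr_gt0.
pose n := (Num.truncn (L * expR (p * x))).+1.
have LE0 : 0 <= L * expR (p * x) by rewrite mulr_ge0 ?expR_ge0// ltW.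
have n_ge : L * expR (p * x) <= n%:R by apply/ltW/truncnS_gt.
have n_le : n%:R <= L * expR (p * x) + 1.
  by rewrite /n -natr1 lerD2r truncn_le.
have y01 t : 0 <= t -> 0 <= expR (- (p * t)) <= 1.
  move=> t0; rewrite expR_ge0/= -expR0 ler_expR oppr_le0 mulr_ge0//.
  exact: ltW.
exists p, n; split; first exact: ltW.
- move=> t /andP[t0 tx]; have := bernoulli_upper n (y01 t t0).
  rewrite -/(gumbel p n t); set g := gumbel p n t => h.
  have g0 : 0 <= g by case/andP: (gumbel01 n (ltW p0) t0).
  have : L <= n%:R * expR (- (p * t)).
    apply: (@le_trans _ _ (L * expR (p * x) * expR (- (p * t)))).
      rewrite -mulrA -expRD -[leLHS]mulr1; apply: ler_wpM2l; first exact: ltW.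
      by rewrite -expR0 ler_expR -mulrBr mulr_ge0 ?subr_ge0// ltW.
    by rewrite ler_wpM2r// expR_ge0.
  move=> LnE; have : g * L <= 1.
    apply: le_trans h; apply: ler_wpM2l => //.
    by apply: le_trans LnE _; rewrite lerDr.
  by rewrite -ler_pdivlMr// mul1r /L invrK.
- move=> t x't; have t0 : 0 <= t by lra.
  have := bernoulli_lower n (y01 t t0); rewrite -/(gumbel p n t).
  apply: le_trans; rewrite lerD2l lerN2.
  apply: (@le_trans _ _ ((L + 1) * expR (- (p * (x' - x))))).
    apply: (@le_trans _ _ ((L * expR (p * x) + 1) * expR (- (p * x')))).
      apply: ler_pM; rewrite ?expR_ge0 ?ler0n//.
      by rewrite ler_expR lerN2 ler_wpM2l// ltW.
    rewrite mulrDl -mulrA -expRD mul1r mulrDl mul1r.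
    have -> : p * x - p * x' = - (p * (x' - x)) by ring.
    rewrite lerD2l ler_expR lerN2 ler_wpM2l//; first exact: ltW.
    by rewrite gerBl.
  have := expRN_le (ltW (mulr_gt0 p0 D0)).
  have -> : p * (x' - x) = (L + 1) / eta.
    by rewrite /p; field; rewrite gt_eqF//= gt_eqF.
  set e := expR _ => he; apply: (@le_trans _ _
    ((L + 1) * (1 + (L + 1) / eta)^-1)).
    by rewrite ler_wpM2l//; lra.
  rewrite ler_pdivrMr; last by rewrite addr_gt0// divr_gt0//; lra.
  have -> : eta * (1 + (L + 1) / eta) = eta + (L + 1) by field; rewrite gt_eqF.
  by lra.
Qed.

(** By the binomial theorem only finitely many values of the Laplace transform enter, so convergence
    of transforms carries over to these means. *)
Lemma mean_gumbel (R : realType) (u : nat -> R) (eps p : R) n :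
  (forall k, 0 <= u k) -> \sum_(k < N) u k @[N --> \oo] --> (1 : R) ->
  0 <= eps -> 0 <= p ->
  mean u (fun k => gumbel p n (eps * k%:R)) =
  \sum_(j < n.+1) ((-1) ^+ j *+ 'C(n, j)) * laplace u (p *+ j * eps).
Proof.
move=> u0 u1 eps0 p0; rewrite -mean_lin//; last first.
  move=> j k; rewrite expR_ge0 -expR0 ler_expR oppr_le0 !mulr_ge0//.
  by rewrite mulrn_wge0.
congr mean; apply/funext => k; rewrite /gumbel exprDn; apply: eq_bigr => j _.
rewrite expr1n mul1r [in LHS]exprNn -expRM_natl [RHS]mulrnAl;
  congr (_ * expR _ *+ _).
by rewrite -mulr_natr; ring.
Qed.

(** * The geometric comparison law *)

Definition geo (R : realType) (r : R) (k : nat) : R := (1 - r) * r ^+ k.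

Section geometric.
Context (R : realType) (r : R).
Hypothesis r01 : 0 <= r < 1.

Lemma geo_ge0 k : 0 <= geo r k.
Proof.
by case/andP: r01 => r0 r1; rewrite mulr_ge0 ?exprn_ge0// subr_ge0 ltW.
Qed.

Lemma geo_partial N : \sum_(k < N) geo r k = 1 - r ^+ N.
Proof. by rewrite -mulr_sumr -[RHS]opprB subrX1 -mulNr opprB. Qed.

Lemma geo_sum : \sum_(k < N) geo r k @[N --> \oo] --> (1 : R).
Proof.
under eq_fun do rewrite geo_partial.
suff : 1 - r ^+ N @[N --> \oo] --> (1 - 0 : R) by rewrite subr0.
apply: cvgB; first exact: cvg_cst.
by apply: cvg_expr; case/andP: r01 => r0 r1; rewrite ger0_norm.
Qed.

Lemma laplace_geo s : 0 <= s ->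
  laplace (geo r) s = (1 - r) / (1 - r * expR (- s)).
Proof.
case/andP: r01 => r0 r1 s0; apply: cvg_lim => //.
set x := r * expR (- s).
have x0 : 0 <= x by rewrite mulr_ge0 ?expR_ge0.
have x1 : x < 1.
  by apply: le_lt_trans r1; rewrite ler_piMr// -expR0 ler_expR oppr_le0.
have E N : \sum_(k < N) expR (- (s * k%:R)) * geo r k =
    (1 - r) / (1 - x) * (1 - x ^+ N).
  have -> : 1 - x ^+ N = (1 - x) * \sum_(k < N) x ^+ k.
    by rewrite -[LHS]opprB subrX1 -mulNr opprB.
  rewrite mulrA divfK; last first.
    by rewrite subr_eq0 gt_eqF.
  rewrite mulr_sumr; apply: eq_bigr => k _.
  rewrite /x exprMn -expRM_natl /geo.
  have -> : - (s * k%:R) = k%:R * - s by ring.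
  by ring.
under eq_fun do rewrite E.
suff : (1 - r) / (1 - x) * (1 - x ^+ N) @[N --> \oo] -->
    ((1 - r) / (1 - x) * (1 - 0) : R).
  by rewrite subr0 mulr1.
apply: cvgMr; apply: cvgB; first exact: cvg_cst.
by apply: cvg_expr; rewrite ger0_norm.
Qed.

End geometric.

(** With [K = floor(x / eps)], the tail beyond [K] is [r^(K+1) = exp(- (K+1) eps / m)], and
    [x < (K+1) eps <= x + eps]. *)
Lemma dcdf_geo (R : realType) (m eps x : R) : 0 < m -> 0 < eps -> 0 <= x ->
  1 - expR (- (x / m)) <= dcdf (geo (expR (- (eps / m)))) eps x
    <= 1 - expR (- ((x + eps) / m)).
Proof.
move=> m0 e0 x0; set r := expR (- (eps / m)); pose K := Num.truncn (x / eps).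
have xe0 : 0 <= x / eps by rewrite divr_ge0// ltW.
have K1 : K%:R * eps <= x by rewrite -ler_pdivlMr// truncn_le.
have K2 : x < K.+1%:R * eps by rewrite -ltr_pdivrMr// truncnS_gt.
have -> : dcdf (geo r) eps x = 1 - r ^+ K.+1.
  apply: cvg_lim => //; apply: cvg_near_cst.
  exists K.+1 => // N /= KN; rewrite -geo_partial (big_ord_widen _ (geo r) KN).
  rewrite [RHS]big_mkcond; apply: eq_bigr => k _.
  have -> : (eps * k%:R <= x) = (k < K.+1)%N.
    rewrite ltnS; apply/idP/idP => [ekx|kK].
      rewrite -ltnS -(ltr_nat R) -(ltr_pM2l e0); apply: le_lt_trans ekx _.
      by rewrite mulrC.
    by apply: le_trans K1; rewrite mulrC ler_wpM2r ?ler_nat// ltW.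
  by case: ifP; rewrite ?mul1r ?mul0r.
rewrite -expRM_natl !lerD2l !lerN2 !ler_expR !mulrN !lerN2 mulrA.
rewrite !ler_pM2r ?invr_gt0//; apply/andP; split; first exact: ltW.
by rewrite -natr1 mulrDl mul1r lerD2r.
Qed.

(** The complement of [gumbel] lies between the indicators of [t <= x] and [t <= x'] up to [eta],
    which is paid twice. Exchanging [u] and [v] gives the opposite bound. *)
Lemma dcdf_compare (R : realType) (u v : nat -> R) (eps x x' p eta : R) n :
  (forall k, 0 <= u k) -> \sum_(k < N) u k @[N --> \oo] --> (1 : R) ->
  (forall k, 0 <= v k) -> \sum_(k < N) v k @[N --> \oo] --> (1 : R) ->
  0 < eps -> 0 <= p -> 0 <= eta ->
  (forall t, 0 <= t <= x -> gumbel p n t <= eta) ->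
  (forall t, x' <= t -> 1 - eta <= gumbel p n t) ->
  dcdf u eps x <= dcdf v eps x' + eta *+ 2
    + (mean v (fun k => gumbel p n (eps * k%:R))
       - mean u (fun k => gumbel p n (eps * k%:R))).
Proof.
move=> u0 u1 v0 v1 e0 p0 eta0 gx gx'.
have g01 k : 0 <= gumbel p n (eps * k%:R) <= 1.
  by apply: gumbel01 => //; rewrite mulr_ge0// ltW.
have c01 (a b : R) : 0 <= (if a <= b then 1 else 0 : R) <= 1.
  by case: ifP; rewrite ?ler01 lexx.
have cg01 k : 0 <= 1 - gumbel p n (eps * k%:R) <= 1.
  by have := g01 k; lra.
have H1 : dcdf u eps x <= mean u (fun k => 1 - gumbel p n (eps * k%:R)) + eta.
  apply: mean_le => // k; case: ifPn => [kx|_]; last by have := g01 k; lra.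
  have h : 0 <= eps * k%:R <= x by rewrite kx andbT mulr_ge0// ltW.
  by have := gx _ h; lra.
have H2 : mean v (fun k => 1 - gumbel p n (eps * k%:R)) <= dcdf v eps x' + eta.
  apply: mean_le => // k; case: ifPn => [_|]; first by have := g01 k; lra.
  by rewrite -ltNge => /ltW /gx'; lra.
rewrite mean_compl// in H1; rewrite mean_compl// in H2.
by lra.
Qed.

(** * Convergence of distribution functions from convergence of transforms *)

Section exponential_limit.
Context (R : realType) (I : Type) (F : set_system I) {FF : ProperFilter F}.
Context (eps : I -> R).
Hypotheses (eps_gt0 : \forall i \near F, 0 < eps i)
  (eps_cvg : eps i @[i --> F] --> (0 : R)).

(** Squeezed between [a / (1 + a eps)] and [a], both consequences of [1 + y <= e^y]. *)
Lemma cvg_one_sub_expR (a : R) : 0 <= a ->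
  (1 - expR (- (a * eps i))) / eps i @[i --> F] --> a.
Proof.
move=> a0; apply: (@squeeze_cvgr _ _ _ _ (fun i => a / (1 + a * eps i))
  (cst a)).
- near=> i; have e0 : 0 < eps i by near: i.
  have ae0 : 0 <= a * eps i by rewrite mulr_ge0// ltW.
  have D0 : 0 < 1 + a * eps i by rewrite ltr_wpDr.
  have e1 := expR_ge1Dx (- (a * eps i)).
  have e2 := expRN_le ae0.
  rewrite ler_pdivlMr// ler_pdivrMr//.
  apply/andP; split; last by rewrite /cst; lra.
  have -> : a / (1 + a * eps i) * eps i = 1 - (1 + a * eps i)^-1.
    by field; rewrite gt_eqF.
  by lra.
- suff : a / (1 + a * eps i) @[i --> F] --> (a / (1 + a * 0) : R).
    by rewrite mulr0 addr0 divr1.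
  apply: cvgMr; apply: cvgV; first by rewrite mulr0 addr0.
  by apply: cvgD; [exact: cvg_cst|exact: cvgMr].
- exact: cvg_cst.
Unshelve. all: by end_near. Qed.

Context (m : R) (m_gt0 : 0 < m).
Let v i := geo (expR (- (eps i / m))).

(** The transform [(1 - r) / (1 - r e^(- s eps))] is a ratio of two difference quotients of the
    exponential, with limits [1 / m] and [1 / m + s]. *)
Lemma cvg_laplace_geo s : 0 <= s ->
  laplace (v i) (s * eps i) @[i --> F] --> (1 + m * s)^-1.
Proof.
move=> s0; have im0 : 0 < m^-1 by rewrite invr_gt0.
suff : ((1 - expR (- (m^-1 * eps i))) / eps i) /
  ((1 - expR (- ((m^-1 + s) * eps i))) / eps i)
    @[i --> F] --> m^-1 / (m^-1 + s).
  have -> : m^-1 / (m^-1 + s) = (1 + m * s)^-1.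
    by field; rewrite !gt_eqF // ltr_wpDr// mulr_ge0// ltW.
  apply: cvg_trans; apply: near_eq_cvg; near=> i.
  have e0 : 0 < eps i by near: i.
  have r01 : 0 <= expR (- (eps i / m)) < 1.
    by rewrite expR_ge0 -expR0 ltr_expR oppr_lt0 divr_gt0.
  rewrite laplace_geo ?mulr_ge0 ?(ltW e0)// -expRD.
  have -> : - (eps i / m) + - (s * eps i) = - ((m^-1 + s) * eps i) by ring.
  have -> : - (eps i / m) = - (m^-1 * eps i) by ring.
  field; rewrite (gt_eqF e0) andbT subr_eq0 gt_eqF// -expR0 ltr_expR.
  by rewrite oppr_lt0 mulr_gt0// ltr_pwDl.
have ms0 : 0 < m^-1 + s by rewrite ltr_pwDl.
apply: cvgM; first exact/cvg_one_sub_expR/ltW.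
by apply: cvgV; [rewrite gt_eqF|exact/cvg_one_sub_expR/ltW].
Unshelve. all: by end_near. Qed.

Context (u : I -> nat -> R).
Hypotheses (u_ge0 : \forall i \near F, forall k, 0 <= u i k)
  (u_sum : \forall i \near F, \sum_(k < N) u i k @[N --> \oo] --> (1 : R))
  (u_laplace : forall s, 0 <= s ->
    laplace (u i) (s * eps i) @[i --> F] --> (1 + m * s)^-1).

Lemma cvg_gumbel_diff p n : 0 <= p ->
  mean (u i) (fun k => gumbel p n (eps i * k%:R)) -
  mean (v i) (fun k => gumbel p n (eps i * k%:R)) @[i --> F] --> (0 : R).
Proof.
move=> p0.
have : \sum_(j < n.+1) ((-1) ^+ j *+ 'C(n, j)) *
    (laplace (u i) (p *+ j * eps i) - laplace (v i) (p *+ j * eps i)) @[i --> F]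
    --> \sum_(j < n.+1) ((-1) ^+ j *+ 'C(n, j)) *
      ((1 + m * (p *+ j))^-1 - (1 + m * (p *+ j))^-1).
  apply: cvg_sum_ord => j; apply: cvgMr.
  by apply: cvgB; [apply: u_laplace|apply: cvg_laplace_geo]; rewrite mulrn_wge0.
rewrite [X in _ --> X]big1; last by move=> j _; rewrite subrr mulr0.
apply: cvg_trans; apply: near_eq_cvg; near=> i.
have e0 : 0 < eps i by near: i.
have r01 : 0 <= expR (- (eps i / m)) < 1.
  by rewrite expR_ge0 -expR0 ltr_expR oppr_lt0 divr_gt0.
have v0 := geo_ge0 r01; have v1 := geo_sum r01.
have u0 : forall k, 0 <= u i k by near: i.
have u1 : \sum_(k < N) u i k @[N --> \oo] --> (1 : R) by near: i.
rewrite (mean_gumbel _ u0 u1 (ltW e0) p0) (mean_gumbel _ v0 v1 (ltW e0) p0).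
by rewrite -sumrB; apply: eq_bigr => j _; rewrite mulrBr.
Unshelve. all: by end_near. Qed.

Lemma expRN_lipschitz (a b : R) : 0 <= a -> a <= b ->
  expR (- a) - expR (- b) <= b - a.
Proof.
move=> a0 ab; have -> : expR (- b) = expR (- a) * expR (- (b - a)).
  by rewrite -expRD; congr expR; ring.
have := expR_ge1Dx (- (b - a)); have : expR (- a) <= 1.
  by rewrite -expR0 ler_expR oppr_le0.
have := expR_gt0 (- a); set A := expR (- a); set B := expR _.
move=> A0 A1 B1; have -> : A - A * B = A * (1 - B) by ring.
apply: le_trans (_ : A * (b - a) <= _); first by rewrite ler_pM2l//; lra.
by rewrite ler_piMl// subr_ge0.
Qed.

Lemma cvg_dcdf_exponential x : 0 <= x ->
  dcdf (u i) (eps i) x @[i --> F] --> 1 - expR (- (x / m)).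
Proof.
move=> x0; apply/cvgrPdist_le => e e0.
(* Error budget: shifting [x] by [del] costs [e / 4], the mesh [eps i <= del] at most another
   [e / 4], the two step errors [e / 8] each, and the difference of the [gumbel] means [e / 8]. *)
pose del := m * (e / 4); have del0 : 0 < del by rewrite mulr_gt0// divr_gt0.
have eta0 : 0 < e / 8 by rewrite divr_gt0.
have delm : del / m = e / 4 by rewrite /del; field; rewrite gt_eqF.
have xxd : x < x + del by rewrite ltrDl.
have [p1 [n1 [p10 A1 B1]]] := gumbel_step x0 xxd eta0.
have small_eps : \forall i \near F, eps i <= del.
  have /cvgrPdist_le/(_ _ del0) := eps_cvg.
  apply: filterS => i; rewrite sub0r normrN.
  by apply: le_trans; exact: ler_norm.
have diff p n : 0 <= p -> \forall i \near F,
  `|mean (u i) (fun k => gumbel p n (eps i * k%:R)) -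
    mean (v i) (fun k => gumbel p n (eps i * k%:R))| <= e / 8.
  move=> p0; have /cvgrPdist_le/(_ _ eta0) := @cvg_gumbel_diff p n p0.
  by apply: filterS => i; rewrite sub0r normrN.
have geoP : \forall i \near F, (forall k, 0 <= v i k) /\
    \sum_(k < N) v i k @[N --> \oo] --> (1 : R).
  near=> i; have e0' : 0 < eps i by near: i.
  have r01 : 0 <= expR (- (eps i / m)) < 1.
    by rewrite expR_ge0 -expR0 ltr_expR oppr_lt0 divr_gt0.
  by split; [move=> k; exact: geo_ge0|exact: geo_sum].
have upper : \forall i \near F,
  dcdf (u i) (eps i) x <= 1 - expR (- (x / m)) + e.
  near=> i.
  have ei0 : 0 < eps i by near: i.
  have [vi0 vi1] : (forall k, 0 <= v i k) /\
    \sum_(k < N) v i k @[N --> \oo] --> (1 : R) by near: i.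
  have ui0 : forall k, 0 <= u i k by near: i.
  have ui1 : \sum_(k < N) u i k @[N --> \oo] --> (1 : R) by near: i.
  have := dcdf_compare ui0 ui1 vi0 vi1 ei0 p10 (ltW eta0) A1 B1.
  have : `|mean (u i) (fun k => gumbel p1 n1 (eps i * k%:R)) -
    mean (v i) (fun k => gumbel p1 n1 (eps i * k%:R))| <= e / 8.
    by near: i; exact: diff.
  have xd0 : 0 <= x + del by lra.
  have /andP[_] := dcdf_geo m_gt0 ei0 xd0.
  have ed : eps i <= del by near: i.
  have edm : eps i / m <= e / 4 by rewrite -delm ler_pM2r ?invr_gt0.
  have xm0 : 0 <= x / m by rewrite divr_ge0// ltW.
  have em0 : 0 <= eps i / m by rewrite divr_ge0// ltW.
  have := @expRN_lipschitz (x / m) ((x + del + eps i) / m) xm0.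
  rewrite !mulrDl delm => h1 h2 /ler_normlP[h3 h4] h5.
  have := h1 (ltac:(lra)).
  by move: h2 h3 h4 h5; rewrite /v mulr2n; lra.
have lower : \forall i \near F,
  1 - expR (- (x / m)) - e <= dcdf (u i) (eps i) x.
  (* For [x < del] the lower target is negative, since [1 - e^(- x / m) <= x / m < e / 4]. *)
  have [xd|xd] := ltP x del.
    near=> i.
    have ui0 : forall k, 0 <= u i k by near: i.
    have ui1 : \sum_(k < N) u i k @[N --> \oo] --> (1 : R) by near: i.
    apply: (@le_trans _ _ 0); last first.
      by apply: mean_ge0 => // k; case: ifP; rewrite ?ler01 lexx.
    have : x / m < e / 4 by rewrite -delm ltr_pM2r ?invr_gt0.
    by have := expR_ge1Dx (- (x / m)); lra.
  have xd0 : 0 <= x - del by lra.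
  have xdx : x - del < x by rewrite gtrBl.
  have [p2 [n2 [p20 A2 B2]]] := gumbel_step xd0 xdx eta0.
  near=> i.
  have ei0 : 0 < eps i by near: i.
  have [vi0 vi1] : (forall k, 0 <= v i k) /\
    \sum_(k < N) v i k @[N --> \oo] --> (1 : R) by near: i.
  have ui0 : forall k, 0 <= u i k by near: i.
  have ui1 : \sum_(k < N) u i k @[N --> \oo] --> (1 : R) by near: i.
  have := dcdf_compare vi0 vi1 ui0 ui1 ei0 p20 (ltW eta0) A2 B2.
  have : `|mean (u i) (fun k => gumbel p2 n2 (eps i * k%:R)) -
    mean (v i) (fun k => gumbel p2 n2 (eps i * k%:R))| <= e / 8.
    by near: i; exact: diff.
  have /andP[+ _] := dcdf_geo m_gt0 ei0 xd0.
  have xm0 : 0 <= (x - del) / m by rewrite divr_ge0// ltW.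
  have := @expRN_lipschitz ((x - del) / m) (x / m) xm0.
  rewrite mulrBl delm => h1 h2 /ler_normlP[h3 h4] h5.
  have := h1 (ltac:(lra)).
  by move: h2 h3 h4 h5; rewrite /v mulr2n; lra.
near=> i; rewrite ler_norml.
have : dcdf (u i) (eps i) x <= 1 - expR (- (x / m)) + e by near: i.
have : 1 - expR (- (x / m)) - e <= dcdf (u i) (eps i) x by near: i.
by lra.
Unshelve. all: by end_near. Qed.

End exponential_limit.

(** * Heavy traffic *)

(** The density vanishes on the negative half-line, which reduces the integral to [[0, x]]. *)
Lemma exponential_prob_cdf (R : realType) (m x : R) :
  exponential_of_mean m `]-oo, x]%classic =
  (if 0 <= x then 1 - expR (- (x / m)) else 0)%:E.
Proof.
rewrite /exponential_of_mean.
have -> : exponential_prob m^-1 `]-oo, x]%classic =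
    exponential_prob m^-1 `[0, x]%classic.
  have pdf0 : (fun t : R => (exponential_pdf m^-1 t)%:E) =
      (fun t => (exponential_pdf m^-1 t)%:E) \_ `[0, +oo[.
    apply/funext => t; rewrite patchE; case: ifPn => // /negP t0.
    rewrite lt0_exponential_pdf// ltNge; apply/negP => t1; apply: t0.
    by rewrite inE/= in_itv/= t1.
  rewrite /exponential_prob pdf0 -!integral_mkcondr; congr (integral _ _ _).
  apply/seteqP; split => t /=; rewrite !in_itv/= !andbT => -[];
    by [move=> ->->|move=> /andP[->->]].
case: ltgtP => x0.
- by rewrite exponential_prob_itv0c// mulNr mulrC EFinB.
- rewrite set_itv_ge; first exact: integral_set0.
  by rewrite bnd_simp -ltNge.
- by rewrite -x0 set_itv1 mul0r oppr0 expR0 subrr; exact: integral_set1.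
Qed.

(** * The law of the queue as a real mass function *)

Section law.
Context (R : realType) (d : nat) (dO : measure_display)
  (Omega : measurableType dO) (P : probability Omega R)
  (Q : {RV P >-> nat}) (J : Omega -> 'I_d).
Hypothesis J_meas : forall i, measurable (J @^-1` [set i]).

Definition law (k : nat) (i : 'I_d) : R := fine (joint_law Q J (k, i)).

Let mQ (A : set nat) : measurable (Q @^-1` A).
Proof. by rewrite -[X in measurable X]setTI; exact: measurable_funP. Qed.

Let eventE k i : [set w | (Q w, J w) = (k, i)] =
  Q @^-1` [set k] `&` J @^-1` [set i].
Proof. by apply/seteqP; split => w /=; [case=> -> ->|case=> -> ->]. Qed.

Let m_event k i : measurable [set w | (Q w, J w) = (k, i)].
Proof. by rewrite eventE; exact: measurableI. Qed.

Lemma lawE k i : (law k i)%:E = joint_law Q J (k, i).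
Proof. by rewrite /law fineK//; apply: fin_num_measure. Qed.

Lemma law_ge0 k i : 0 <= law k i.
Proof. by rewrite -lee_fin lawE. Qed.

Lemma law_marginal k : (\sum_i law k i)%:E = P (Q @^-1` [set k]).
Proof.
rewrite -sumEFin; under eq_bigr do rewrite lawE /joint_law.
rewrite -measure_bigsetU_ord//.
  congr (P _); rewrite -bigcup_seq_cond; apply/seteqP; split => w /=.
    by move=> [i _] [].
  by move=> <-; exists (J w); rewrite /= ?mem_index_enum.
apply/trivIsetP => i j _ _ ij; apply/seteqP; split => // w [/= [_ Ji] [_ Jj]].
by move: ij; rewrite -Ji -Jj eqxx.
Qed.

(** Countable additivity over levels. The predicate [f] covers both the total mass and the
    distribution function. *)
Lemma law_sum (f : pred nat) :
  \sum_(k < N) (if f k then 1 else 0) * (\sum_i law k i) @[N --> \oo] -->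
  fine (P [set w | f (Q w)]).
Proof.
pose A k := if f k then Q @^-1` [set k] else set0.
have mA k : measurable (A k) by rewrite /A; case: ifP.
have tA : trivIset setT A.
  apply/trivIsetP => i j _ _ ij; rewrite /A.
  case: ifP; case: ifP; rewrite ?setI0 ?set0I// => _ _.
  apply/seteqP; split => // w [/= Qi Qj].
  by move: ij; rewrite -Qi -Qj eqxx.
have UA : \bigcup_k A k = [set w | f (Q w)].
  apply/seteqP; split => w.
    by move=> [k _]; rewrite /A; case: ifP => //= fk ->.
  by move=> /= fw; exists (Q w) => //; rewrite /A fw.
have Ffin : P [set w | f (Q w)] = (fine (P [set w | f (Q w)]))%:E.
  by rewrite fineK// fin_num_measure//; exact: (mQ [set k | f k]).
have : (fun N => (\sum_(0 <= k < N) P (A k))%E) @ \oo -->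
    (fine (P [set w | f (Q w)]))%:E.
  by rewrite -Ffin -UA; exact: measure_sigma_additive.
move=> /fine_cvgP[_]; apply: cvg_trans; apply: near_eq_cvg.
apply: nearW => N /=; apply: EFin_inj; rewrite fineK.
  rewrite big_mkord -sumEFin; apply: eq_bigr => k _.
  by rewrite /A; case: ifP => _; rewrite ?mul1r ?mul0r ?law_marginal ?measure0.
by apply/sum_fin_numP => k _ _; exact: fin_num_measure.
Qed.

Lemma law_total : \sum_(k < N) \sum_i law k i @[N --> \oo] --> (1 : R).
Proof.
have := @law_sum xpredT.
have -> : [set w | xpredT (Q w)] = setT by apply/seteqP.
by rewrite probability_setT/=; under eq_fun do under eq_bigr do rewrite mul1r.
Qed.

Lemma cdf_scaled a x :
  cdf (scaled_rv a Q) x = (dcdf (fun k => \sum_i law k i) a x)%:E.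
Proof.
rewrite /cdf /distribution /pushforward /dcdf.
have -> : scaled_rv a Q @^-1` `]-oo, x] = [set w | a * (Q w)%:R <= x].
  by apply/seteqP; split => w /=; rewrite in_itv.
have := @law_sum (fun k => a * k%:R <= x) => /(cvg_lim (@Rhausdorff R)) h.
rewrite /mean h fineK// fin_num_measure//.
exact: (mQ [set k | a * k%:R <= x]).
Qed.

Lemma law_stationary r : stationary r (joint_law Q J) ->
  stationary r (fun x => (law x.1 x.2)%:E).
Proof.
suff -> : joint_law Q J = (fun x => (law x.1 x.2)%:E) by [].
by apply/funext => -[k i]; rewrite lawE.
Qed.

End law.

(** * Heavy-traffic limit of the transform *)

Section heavy_traffic.
Context (R : realType) (d : nat) (q : 'M[R]_d) (lam0 mu : 'cV[R]_d).
Hypotheses (q_gen : is_generator q) (q_irr : irreducible_chain q).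
Context (p : 'rV[R]_d) (p_ge0 : forall i, 0 <= p 0 i)
  (p_sum : \sum_i p 0 i = 1) (p_stat : p *m q = 0).
Hypotheses (mu_ge0 : forall i, 0 <= mu i 0) (pmu_gt0 : 0 < rc p mu).
Context (rho0 : R) (rho0_def : rho0 = load p lam0 mu) (rho0_gt0 : 0 < rho0).
Context (k : 'I_d).
Let cs := rho0^-1.
Local Notation F := cs^'-.
Let eps c := 1 - load p (c *: lam0) mu.
Let drift c := \sum_i p 0 i * (c * lam0 i 0 - mu i 0).

Lemma rc_scale c : rc p (c *: lam0) = c * rc p lam0.
Proof. by rewrite /rc -scalemxAr mxE. Qed.

Lemma epsE c : eps c = 1 - c * rho0.
Proof. by rewrite /eps /load rc_scale rho0_def mulrA. Qed.

Lemma rc_lam0 : rc p lam0 = rho0 * rc p mu.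
Proof. by rewrite rho0_def /load divfK// gt_eqF. Qed.

Lemma driftE c : drift c = - (eps c * rc p mu).
Proof.
have -> : drift c = c * rc p lam0 - rc p mu.
  rewrite /drift /rc !mxE mulr_sumr -sumrB; apply: eq_bigr => i _; ring.
by rewrite rc_lam0 epsE; ring.
Qed.

Lemma eps_crit : eps cs = 0.
Proof. by rewrite epsE mulVf ?subrr// gt_eqF. Qed.

Lemma cvg_id_left : c @[c --> F] --> cs.
Proof. by apply: cvg_at_left_filter; exact: cvg_id. Qed.

Lemma cvg_eps : eps c @[c --> F] --> (0 : R).
Proof.
rewrite -[X in _ --> X]eps_crit epsE; under eq_fun do rewrite epsE.
apply: cvgB; first exact: cvg_cst.
by apply: cvgM; [exact: cvg_id_left|exact: cvg_cst].
Qed.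

Lemma eps_gt0 : \forall c \near F, 0 < eps c.
Proof.
near=> c; rewrite epsE subr_gt0 -ltr_pdivlMr// div1r; near: c.
exact: nbhs_left_lt.
Unshelve. all: by end_near. Qed.

Context (B : {poly {poly R}}) (BE : forall c z,
  det_quot q (c *: lam0) mu k z = tau q * drift c + (z - 1) * bieval c z B).
Let V := bieval cs 1 B / tau q.

(** At the critical scale [mu - lambda] is annihilated by [p], so [q y = mu - lambda] is solvable;
    the excess of [V] over [rc p mu] is the Dirichlet form of [y]. *)
Lemma critical_variance : rc p mu <= V.
Proof.
have d_gt0 : (0 < d)%N := leq_ltn_trans (leq0n k) (ltn_ord k).
have drift0 : drift cs = 0 by rewrite driftE eps_crit mul0r oppr0.
have [|y qy] := @generator_poisson _ _ _ q_gen q_irr d_gt0 _ p_stat p_sum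
  (mu - cs *: lam0).
  apply/matrixP => i j; rewrite !ord1 mxE [RHS]mxE.
  transitivity (- drift cs); last by rewrite drift0 oppr0.
  by rewrite /drift -sumrN; apply: eq_bigr => l _; rewrite !mxE; ring.
have Bz z : det_quot q (cs *: lam0) mu k z = (z - 1) * bieval cs z B.
  by rewrite BE drift0 mulr0 add0r.
rewrite /V (bieval_quot1 q_gen q_irr p_stat p_sum Bz qy).
have tn0 := generator_tau_neq0 q_gen q_irr d_gt0 p_stat p_sum.
rewrite mulrC mulKf// lerDl.
have := generator_dirichlet q_gen p_stat y p_ge0; rewrite qy -sumrN.
congr (_ <= _); apply: eq_bigr => i _; rewrite !mxE; ring.
Qed.

(** The first-order term of [derive2_alpha] is proportional to the drift, which vanishes at the
    critical scale. *)
Lemma alpha_circE : alpha_circ q lam0 mu rho0 = 2 * tau q * V.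
Proof.
have d_gt0 : (0 < d)%N := leq_ltn_trans (leq0n k) (ltn_ord k).
have tn0 := generator_tau_neq0 q_gen q_irr d_gt0 p_stat p_sum.
have VE : 2 * tau q * V = 2 * bieval cs 1 B - 2 * d%:R * (tau q * 0).
  by rewrite /V; field.
rewrite VE; apply: cvg_lim => //.
have E c : derive1n 2 (alpha q (c *: lam0) mu) 1 =
    2 * bieval c 1 B - 2 * d%:R * (tau q * drift c).
  apply: derive2_alpha => z.
  by rewrite (det_zA _ _ (generator_row_sum q_gen) k) BE.
under eq_fun do rewrite E.
apply: cvgB.
  by apply: cvgMr; apply: cvg_bieval; [exact: cvg_id_left|exact: cvg_cst].
apply: cvgMr; apply: cvgMr.
have -> : drift = (fun c => - (eps c * rc p mu)).
  by apply/funext => c; exact: driftE.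
have -> : (0 : R) = - (0 * rc p mu) by rewrite mul0r oppr0.
by apply: cvgN; apply: cvgM; [exact: cvg_eps|exact: cvg_cst].
Qed.

Context (pr : R -> nat -> 'I_d -> R).
Hypotheses (pr_ge0 : forall c k i, 0 <= pr c k i)
  (pr_sum : forall c, \sum_(k < N) \sum_i pr c k i @[N --> \oo] --> (1 : R))
  (pr_balance : \forall c \near F, forall k i,
    pr c k i * ((c *: lam0) i 0 + if k is 0 then 0 else mu i 0) =
    (if k is k'.+1 then pr c k' i * (c *: lam0) i 0 else 0) +
    pr c k.+1 i * mu i 0 + \sum_j pr c k j * q j i).
Let u c k := \sum_i pr c k i.

Lemma laplace_gen_fun c s : 0 <= s -> laplace (u c) s =
  \sum_i gen_fun (pr c) (expR (- s)) i 0.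
Proof.
move=> s0; apply: cvg_lim => //.
have -> : (fun N => \sum_(j < N) expR (- (s * j%:R)) * u c j) =
    (fun N => \sum_i gen_partial (pr c) (expR (- s)) i N).
  apply/funext => N; rewrite exchange_big/=; apply: eq_bigr => j _.
  rewrite mulr_sumr; apply: eq_bigr => i _; rewrite -expRM_natl.
  by congr (expR _ * _); ring.
apply: cvg_sum_ord => i; apply: cvg_gen_fun => //.
by rewrite expR_ge0 -expR0 ler_expR oppr_le0.
Qed.

(** No limit of the individual idle probabilities divided by [eps] is required: the adjugate tends
    to [tau p_i] in every column, so only their [mu]-weighted sum matters, and flow conservation
    fixes it. *)
Lemma cvg_laplace_queue s : 0 <= s ->
  laplace (u c) (s * eps c) @[c --> F] --> (1 + V / rc p mu * s)^-1.
Proof.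
(* The case [s = 0] is apart because [det_gen_fun] requires [z < 1]. *)
rewrite le_eqVlt => /predU1P[<-|s_gt0].
  have E c : laplace (u c) (0 * eps c) = 1.
    apply: cvg_lim => //.
    have -> : (fun N => \sum_(j < N) expR (- (0 * eps c * j%:R)) * u c j) =
        (fun N => \sum_(j < N) u c j).
      apply/funext => N; apply: eq_bigr => j _.
      by rewrite !mul0r oppr0 expR0 mul1r.
    exact: pr_sum.
  have -> : (fun c => laplace (u c) (0 * eps c)) = cst 1 by apply/funext.
  by rewrite mulr0 addr0 invr1; exact: cvg_cst.
have d_gt0 : (0 < d)%N := leq_ltn_trans (leq0n k) (ltn_ord k).
have tn0 := generator_tau_neq0 q_gen q_irr d_gt0 p_stat p_sum.
have V0 : 0 < V by apply: lt_le_trans critical_variance.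
pose z c := expR (- (s * eps c)).
have z1 : z c @[c --> F] --> (1 : R).
  have -> : (1 : R) = expR (- (s * 0)) by rewrite mulr0 oppr0 expR0.
  apply: (@continuous_cvg _ _ _ _ _ _ (@expR R)); first exact: continuous_expR.
  by apply: cvgN; apply: cvgMr; exact: cvg_eps.
have zs : (1 - z c) / eps c @[c --> F] --> s.
  by apply: cvg_one_sub_expR; [exact: eps_gt0|exact: cvg_eps|exact: ltW].
have [A AE] := adj_zA_bieval q lam0 mu.
(* The weights [w] are eventually nonnegative with sum [rc p mu], hence bounded. Dividing Cramer's
   identity by [- eps] turns it into [D] times the transform equal to [N]. *)
pose w c j := mu j 0 * pr c 0 j / eps c.
pose D c := tau q * rc p mu + (1 - z c) / eps c * bieval c (z c) B.
pose N c := \sum_i \sum_j bieval c (z c) (A i j) * w c j.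
have w_sum : \forall c \near F, \sum_j w c j = rc p mu.
  near=> c; have e0 : 0 < eps c by near: c; exact: eps_gt0.
  rewrite /w -mulr_suml.
  rewrite (@gen_fun_idle _ _ q (c *: lam0) mu q_gen (pr c) _ _ _ p)//;
    last by near: c.
  rewrite rc_scale rc_lam0.
  have -> : rc p mu - c * (rho0 * rc p mu) = rc p mu * eps c.
    by rewrite epsE; ring.
  by rewrite mulfK// gt_eqF.
have w01 : \forall c \near F, forall j, 0 <= w c j <= rc p mu.
  near=> c => j; have e0 : 0 < eps c by near: c; exact: eps_gt0.
  have w0 l : 0 <= w c l by rewrite divr_ge0 ?mulr_ge0// ltW.
  rewrite w0/=; have <- : \sum_j w c j = rc p mu by near: c.
  by rewrite (bigD1 j)//= lerDl sumr_ge0.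
have DN : \forall c \near F, D c * laplace (u c) (s * eps c) = N c.
  near=> c; have e0 : 0 < eps c by near: c; exact: eps_gt0.
  have se0 : 0 < s * eps c by rewrite mulr_gt0.
  rewrite laplace_gen_fun ?(ltW se0)// -/(z c).
  have z01 : 0 <= z c < 1 by rewrite /z expR_ge0 -expR0 ltr_expR oppr_lt0.
  have bal : forall k i,
    pr c k i * ((c *: lam0) i 0 + if k is 0 then 0 else mu i 0) =
    (if k is k'.+1 then pr c k' i * (c *: lam0) i 0 else 0) +
    pr c k.+1 i * mu i 0 + \sum_j pr c k j * q j i by near: c.
  have := @det_gen_fun _ _ q (c *: lam0) mu q_gen (pr c) (pr_ge0 c) (pr_sum c)
    bal k (z c) z01.
  rewrite BE driftE => h.
  have -> : D c =
    - (tau q * - (eps c * rc p mu) + (z c - 1) * bieval c (z c) B) / eps c.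
    by rewrite /D; field; rewrite gt_eqF.
  rewrite mulrAC mulNr h opprK mulr_suml; apply: eq_bigr => i _.
  by rewrite mulr_suml; apply: eq_bigr => j _; rewrite AE /w; ring.
have Dlim : D c @[c --> F] --> tau q * rc p mu + s * (tau q * V).
  apply: cvgD; first exact: cvg_cst.
  apply: cvgM => //.
  have -> : tau q * V = bieval cs 1 B by rewrite /V mulrC divfK.
  by apply: cvg_bieval => //; exact: cvg_id_left.
have Alim i j : bieval c (z c) (A i j) @[c --> F] --> tau q * p 0 i.
  rewrite -(generator_adj q_gen q_irr d_gt0 p_stat p_sum i j).
  rewrite -(zA1 q (cs *: lam0) mu) AE.
  by apply: cvg_bieval => //; exact: cvg_id_left.
have Nlim : N c @[c --> F] --> tau q * rc p mu.
  (* Replacing the adjugate by its limit costs a vanishing factor times a bounded weight. *)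
  have : \sum_i \sum_j (bieval c (z c) (A i j) - tau q * p 0 i) * w c j
      @[c --> F] --> \sum_(i < d) \sum_(j < d) (0 : R).
    apply: cvg_sum_ord => i; apply: cvg_sum_ord => j; apply/norm_cvg0P.
    have Adiff : `|bieval c (z c) (A i j) - tau q * p 0 i| * rc p mu
        @[c --> F] --> (0 : R).
      rewrite -(mul0r (rc p mu)); apply: cvgM; last exact: cvg_cst.
      apply/norm_cvg0P; rewrite -(subrr (tau q * p 0 i)).
      by apply: cvgB => //; exact: cvg_cst.
    apply: (squeeze_cvgr _ (cvg_cst 0) Adiff); near=> c.
    have /(_ j)/andP[w0 w1] : forall j, 0 <= w c j <= rc p mu by near: c.
    by rewrite normr_ge0 normrM (ger0_norm w0) ler_wpM2l.
  rewrite big1 => [N0|i _]; last by rewrite big1.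
  have : \sum_i \sum_j (bieval c (z c) (A i j) - tau q * p 0 i) * w c j
      + tau q * rc p mu @[c --> F] --> (0 + tau q * rc p mu : R).
    by apply: cvgD => //; exact: cvg_cst.
  rewrite add0r.
  apply: cvg_trans; apply: near_eq_cvg; near=> c => /=.
  have ws : \sum_j w c j = rc p mu by near: c.
  have -> : tau q * rc p mu = \sum_i \sum_j tau q * p 0 i * w c j.
    under eq_bigr do rewrite -mulr_sumr ws.
    by rewrite -mulr_suml -mulr_sumr p_sum mulr1.
  rewrite /N -big_split/=; apply: eq_bigr => i _.
  by rewrite -big_split/=; apply: eq_bigr => j _; ring.
have Dn0 : tau q * rc p mu + s * (tau q * V) != 0.
  have -> : tau q * rc p mu + s * (tau q * V) = tau q * (rc p mu + s * V).
    by ring.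
  by rewrite mulf_neq0// gt_eqF// addr_gt0// mulr_gt0.
have -> : (1 + V / rc p mu * s)^-1 =
    tau q * rc p mu / (tau q * rc p mu + s * (tau q * V)).
  field; rewrite Dn0 (gt_eqF pmu_gt0) gt_eqF//.
  by rewrite addr_gt0// mulr_gt0.
have : N c / D c @[c --> F] -->
    (tau q * rc p mu / (tau q * rc p mu + s * (tau q * V)) : R).
  by apply: cvgM => //; exact: cvgV.
apply: cvg_trans; apply: near_eq_cvg; near=> c => /=.
have <- : D c * laplace (u c) (s * eps c) = N c by near: c.
rewrite mulrAC divff ?mul1r//; near: c.
exact: cvgr_neq0 Dlim Dn0.
Unshelve. all: by end_near. Qed.

End heavy_traffic.

(** Positivity of the mean is part of the claim, as [exponential_of_mean m] is an exponential law
    only for [m > 0]. *)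
Theorem theorem3p1 (R : realType) (d : nat) (d_gt0 : (0 < d)%N)
    (q : 'M[R]_d) (q_gen : is_generator q) (q_irr : irreducible_chain q)
    (mu lam0 : 'cV[R]_d)
    (mu_ge0 : forall i, 0 <= mu i 0) (lam0_ge0 : forall i, 0 <= lam0 i 0)
    (pi : 'rV[R]_d)
    (pi_stat : stationary (fun i j => q i j) (fun i => (pi 0 i)%:E))
    (pimu_gt0 : 0 < rc pi mu)
    (rho0 : R) (rho0_def : rho0 = load pi lam0 mu) (rho0_in01 : 0 < rho0 < 1)
    (dO : R -> measure_display) (Omega : forall c, measurableType (dO c))
    (P : forall c, probability (Omega c) R)
    (Q : forall c, {RV (P c) >-> nat})
    (J : forall c, Omega c -> 'I_d)
    (J_meas : forall c i, measurable (J c @^-1` [set i]))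
    (QJ_stat : forall c, 0 < c < rho0^-1 ->
       stationary (mm1_rate q (c *: lam0) mu) (joint_law (Q c) (J c))) :
  let m := alpha_circ q lam0 mu rho0 / (2 * tau q * rc pi mu) in
  0 < m /\
  cvg_in_distribution rho0^-1^'- P
    (fun c => scaled_rv (1 - load pi (c *: lam0) mu) (Q c))
    (exponential_of_mean m).
Proof.
move=> m; have [p_ge0 p_sum p_stat] := stationary_generator q_gen pi_stat.
(* Any background state serves as the column index of [det_quot]. *)
have k : 'I_d by exists 0%N.
have rho0_gt0 : 0 < rho0 by case/andP: rho0_in01.
have [B BE] := det_quot_expansion lam0 mu q_gen q_irr p_stat p_sum k.
have tn0 := generator_tau_neq0 q_gen q_irr d_gt0 p_stat p_sum.
pose V := bieval rho0^-1 1 B / tau q.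
have mE : m = V / rc pi mu.
  rewrite /m (alpha_circE q_gen q_irr p_sum p_stat pimu_gt0 rho0_def rho0_gt0
    BE) -/V.
  by field; rewrite tn0 gt_eqF.
have V0 : 0 < V.
  apply: (lt_le_trans pimu_gt0).
  exact: (critical_variance q_gen q_irr p_ge0 p_sum p_stat pimu_gt0 rho0_def
    rho0_gt0 BE).
have m0 : 0 < m by rewrite mE divr_gt0.
split=> // x _; rewrite exponential_prob_cdf.
pose pr c := law (Q c) (J c).
(* Stationarity is assumed for [0 < c < 1 / rho0], so the balance equations hold eventually along
   the filter. *)
have c_in : \forall c \near rho0^-1^'-, 0 < c < rho0^-1.
  near=> c; apply/andP; split; near: c; last exact: nbhs_left_lt.
  by apply: nbhs_left_gt; rewrite invr_gt0.
have bal : \forall c \near rho0^-1^'-, forall k i,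
    pr c k i * ((c *: lam0) i 0 + if k is 0 then 0 else mu i 0) =
    (if k is k'.+1 then pr c k' i * (c *: lam0) i 0 else 0) +
    pr c k.+1 i * mu i 0 + \sum_j pr c k j * q j i.
  near=> c; have cin : 0 < c < rho0^-1 by near: c.
  apply: mm1_balance => //.
    by move=> i; rewrite mxE mulr_ge0//; case/andP: cin => /ltW.
  by apply: law_stationary => //; exact: QJ_stat.
have pr0 c := law_ge0 (Q c) (J_meas c).
have pr1 c := law_total (Q c) (J_meas c).
pose eps c := 1 - load pi (c *: lam0) mu.
pose u c k := \sum_i pr c k i.
have e0 : \forall c \near rho0^-1^'-, 0 < eps c.
  exact: (eps_gt0 rho0_def rho0_gt0).
have ecvg : eps c @[c --> rho0^-1^'-] --> (0 : R).
  exact: (cvg_eps rho0_def rho0_gt0).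
have u0 c j : 0 <= u c j by apply: sumr_ge0 => i _; exact: pr0.
have cdfE c : cdf (scaled_rv (1 - load pi (c *: lam0) mu) (Q c)) x =
    (dcdf (u c) (eps c) x)%:E by exact: cdf_scaled.
under eq_fun do rewrite cdfE.
apply: cvg_EFin; first exact: nearW.
case: ifPn => [x0|].
  apply: (cvg_dcdf_exponential e0 ecvg m0) => //.
  - by apply: nearW.
  - by apply: nearW => c; exact: pr1.
  - move=> s s0; rewrite mE.
    exact: (cvg_laplace_queue q_gen q_irr p_ge0 p_sum p_stat mu_ge0 pimu_gt0
      rho0_def rho0_gt0 BE pr0 pr1 bal).
(* For [x < 0] no level [j] satisfies [eps c * j <= x] once [eps c > 0], so every term of the
   distribution function is 0. *)
rewrite -ltNge => x0.
apply: cvg_near_cst; near=> c => /=.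
have ec0 : 0 < eps c by near: c.
apply: cvg_lim => //; apply: cvg_near_cst; apply: nearW => N.
rewrite big1// => j _; rewrite ifF ?mul0r//.
apply/negbTE; rewrite -ltNge; apply: lt_le_trans x0 _.
by rewrite mulr_ge0// ltW.
Unshelve. all: by end_near. Qed.
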